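(* Let $\mathbb{F},q,\varpi,\mathbb{L},e_{\mathbb{L}},\theta,\pi,\varphi_0,\varphi_{new},\mathbb{E},D,\chi$ and $\{\cdot,\cdot\}$ be as in the context (with $\mathbb{L}/\mathbb{F}$ ramified or unramified). Put $N=\lceil\frac{c(\theta)}{2e_{\mathbb{L}}}\rceil$, $\widetilde{\varphi_{new}}=\pi\left(\begin{pmatrix}\varpi^{c(\theta)/e_{\mathbb{L}}}&0\\0&1\end{pmatrix}\right)\varphi_{new}$ and, for $x\in(\mathcal{O}_{\mathbb{F}}/\varpi^{N}\mathcal{O}_{\mathbb{F}})^\times$, $\varphi_x=\pi\left(\begin{pmatrix}x&0\\0&1\end{pmatrix}\right)\varphi_0$. Suppose that $\{\varphi_x,\varphi_x\}\neq0$ for a single $x\in(\mathcal{O}_{\mathbb{F}}/\varpi^{N}\mathcal{O}_{\mathbb{F}})^\times$. Then all off-diagonal terms $\{\varphi_y,\varphi_{y'}\}$, $y\neq y'$ in $(\mathcal{O}_{\mathbb{F}}/\varpi^{N}\mathcal{O}_{\mathbb{F}})^\times$, vanish, and $$\{\widetilde{\varphi_{new}},\widetilde{\varphi_{new}}\}=\frac{1}{(q-1)q^{N-1}}\{\varphi_x,\varphi_x\}.$$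
   Context: $\mathbb{F}$ is a $p$-adic field with $p\ne2$, residue field of order $q$, uniformizer $\varpi$, ring of integers $\mathcal{O}_{\mathbb{F}}$, valuation $v_{\mathbb{F}}$; $\psi$ is an additive character of $\mathbb{F}$ trivial on $\mathcal{O}_{\mathbb{F}}$ but not on $\varpi^{-1}\mathcal{O}_{\mathbb{F}}$. For a quadratic extension $\mathbb{L}/\mathbb{F}$ with ramification index $e_{\mathbb{L}}$, put $\psi_{\mathbb{L}}=\psi\circ\mathrm{Tr}_{\mathbb{L}/\mathbb{F}}$ and $U_{\mathbb{L}}(m)=1+\varpi_{\mathbb{L}}^m\mathcal{O}_{\mathbb{L}}$. For a multiplicative character $\nu$, $c(\nu)$ is its conductor exponent. The representation $\pi$. $\theta$ is a character of $\mathbb{L}^\times$ with $\theta|_{\mathbb{F}^\times}=1$, $c(\theta)\ge2$, and $c(\theta)$ even if $e_{\mathbb{L}}=2$. Let $\alpha_\theta\in\mathbb{L}^\times$ (chosen of trace $0$ to $\mathbb{F}$) satisfy $\theta(1+u)=\psi_{\mathbb{L}}(\alpha_\theta u)$ for $u\in\varpi_{\mathbb{L}}^{\lceil c(\theta)/2\rceil}\mathcal{O}_{\mathbb{L}}$. Put $D'=\alpha_\theta^{-2}\varpi^{-2c(\theta)/e_{\mathbb{L}}}\in\mathbb{F}$, identify $\sqrt{D'}$ with $\alpha_\theta^{-1}\varpi^{-c(\theta)/e_{\mathbb{L}}}$, and embed $\mathbb{L}=\mathbb{F}(\sqrt{D'})$ in $M_2(\mathbb{F})$ by $x+y\sqrt{D'}\mapsto\begin{pmatrix}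 x & y \\ y D' & x \end{pmatrix}$. Let $\mathcal{B}_1=\varpi M_2(\mathcal{O}_{\mathbb{F}})$, $\mathcal{B}_2=\begin{pmatrix}\varpi\mathcal{O}_{\mathbb{F}}&\mathcal{O}_{\mathbb{F}}\\ \varpi\mathcal{O}_{\mathbb{F}}&\varpi\mathcal{O}_{\mathbb{F}}\end{pmatrix}$, $K_e(m)=1+\mathcal{B}_e^m$, and $J=\mathbb{L}^\times K_{e_{\mathbb{L}}}(\lfloor c(\theta)/2\rfloor)$, $J^1=U_{\mathbb{L}}(1)K_{e_{\mathbb{L}}}(\lfloor c(\theta)/2\rfloor)$, $H^1=U_{\mathbb{L}}(1)K_{e_{\mathbb{L}}}(\lceil c(\theta)/2\rceil)$. The formula $\tilde\theta(l(1+x))=\theta(l)\psi(\mathrm{Tr}(\alpha_\theta x))$ (with $l$ in $\mathbb{L}^\times$ or $U_{\mathbb{L}}(1)$) defines a character on the groups below. If $c(\theta)$ is even, $\tilde\theta$ is a character of $J$; set $\Lambda=\tilde\theta$ and $B^1=J$. If $c(\theta)=2n+1$ is odd (so $e_{\mathbb{L}}=1$), set $B^1=U_{\mathbb{L}}(1)K_2(2n+1)$, which lies between $H^1$ and $J^1$ and on which $\tilde\theta$ is a character; $\Lambda$ is the $q$-dimensional irreducible representation of $J$ with $\Lambda|_{J^1}=\mathrm{Ind}_{B^1}^{J^1}\tilde\theta$, $\Lambda|_{H^1}$ a multiple of $\tilde\theta$, and $\Lambda|_{\mathbb{L}^\times}=\bigoplus_\nu\theta\nu$ over characters $\nu$ of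 $\mathbb{L}^\times$ with $c(\nu)=1$, $\nu|_{\mathbb{F}^\times}=1$. Then $\pi=c\text{-}\mathrm{Ind}_J^{\mathrm{GL}_2(\mathbb{F})}\Lambda$, a supercuspidal representation with trivial central character, with invariant Hermitian inner product $(\cdot,\cdot)$. The minimal vector $\varphi_0\in\pi$ is the vector (unique up to scalar) on which $B^1$ acts by $\tilde\theta$; $\varphi_{new}$ is the newform (the vector, unique up to scalar, fixed by matrices in $\mathrm{GL}_2(\mathcal{O}_{\mathbb{F}})$ with bottom row $\equiv(0,1)\bmod\varpi^{c(\pi)}$, $c(\pi)$ the conductor exponent). Both have norm $1$. $\varphi_x$ depends only on $x\bmod\varpi^N$. The period. $\mathbb{E}=\mathbb{F}(\sqrt{D})$, $v_{\mathbb{F}}(D)\in\{0,1\}$, is a quadratic field extension of $\mathbb{F}$ embedded in $M_2(\mathbb{F})$ by $x+y\sqrt{D}\mapsto\begin{pmatrix} x & y \\ y D & x \end{pmatrix}$; $\chi$ is a character of $\mathbb{E}^\times$ with $\chi|_{\mathbb{F}^\times}=1$; and $\{\varphi,\varphi'\}=\int_{\mathbb{F}^\times\backslash\mathbb{E}^\times}(\pi(t)\varphi,\varphi')\chi(t)\,dt$ for a fixed Haar measure. *)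

(* Defs.v *)
From HB Require Import structures.
From mathcomp Require Import all_boot all_order all_algebra all_field.
From mathcomp Require Import all_classical all_reals all_analysis.
From mathcomp.real_closed Require Import complex.
Set Implicit Arguments.
Unset Strict Implicit.
Unset Printing Implicit Defensive.
Import Order.TTheory GRing.Theory Num.Theory.
Local Open Scope classical_set_scope.
Local Open Scope ring_scope.

Definition ceil_div (a b : nat) : nat := ((a + b.-1) %/ b)%N.

Section Valuation.
Variable K : fieldType.

(* v 0 is a junk value: membership in fractional ideals is expressed by
   [ideal_pow], which treats 0 separately. *)
Record normalized_valuation (v : K -> int) : Prop := NormalizedValuation {
  valM : forall x y, x != 0 -> y != 0 -> v (x * y) = v x + v y;
  valD : forall x y, x != 0 -> y != 0 -> x + y != 0 ->
    Num.min (v x) (v y) <= v (x + y);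
  val_unif : exists x, x != 0 /\ v x = 1 }.

Variable v : K -> int.

Definition ideal_pow (m : int) : set K := [set x | x = 0 \/ m <= v x].

(* U(m) = 1 + ideal_pow m for m > 0, and U(0) is the group of integral units *)
Definition unit_grp (m : nat) : set K :=
  [set x | [/\ x != 0, v x = 0 & ideal_pow m%:Z (x - 1)]].

Definition val_complete : Prop :=
  forall u : nat -> K,
    (forall m : nat, exists n0, forall i j, (n0 <= i)%N -> (n0 <= j)%N ->
       ideal_pow m%:Z (u i - u j)) ->
    exists l, forall m : nat, exists n0, forall i, (n0 <= i)%N ->
       ideal_pow m%:Z (u i - l).

(* r enumerates a complete set of representatives of the residue field *)
Definition residue_card (q : nat) : Prop :=
  exists r : 'I_q -> K, (forall i, ideal_pow 0 (r i)) /\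
    forall x, ideal_pow 0 x -> exists! i, ideal_pow 1 (x - r i).

(* p-adic field of residue characteristic p and residue cardinality q, as a
   complete discretely valued field of characteristic 0 *)
Record padic_field (p q : nat) : Prop := PadicField {
  padic_val : normalized_valuation v;
  padic_complete : val_complete;
  padic_char0 : [pchar K] =i pred0;
  padic_prime : prime p;
  padic_residue_char : ideal_pow 1 p%:R;
  padic_residue_card : residue_card q }.

End Valuation.

Section Characters.
Variables (R : realType) (K : fieldType) (v : K -> int).

(* smooth characters of K^*; nu 0 is a junk value *)
Record mult_char (nu : K -> R[i]) : Prop := MultChar {
  mchar_neq0 : forall x, x != 0 -> nu x != 0;
  mcharM : forall x y, x != 0 -> y != 0 -> nu (x * y) = nu x * nu y;
  mchar_smooth : exists m, forall x, unit_grp v m x -> nu x = 1 }.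

Definition conductor (nu : K -> R[i]) (c : nat) : Prop :=
  (forall x, unit_grp v c x -> nu x = 1) /\
  (forall m, (m < c)%N -> exists x, unit_grp v m x /\ nu x != 1).

(* additive character trivial on the integers, but not on elements of
   valuation at least -1 *)
Record unramified_add_char (psi : K -> R[i]) : Prop := UnramifiedAddChar {
  achar_neq0 : forall x, psi x != 0;
  acharD : forall x y, psi (x + y) = psi x * psi y;
  achar_triv : forall x, ideal_pow v 0 x -> psi x = 1;
  achar_nontriv : exists x, ideal_pow v (-1) x /\ psi x != 1 }.

End Characters.

Section Quadratic.
Variables (F : fieldType) (v : F -> int) (L : fieldExtType F).

Record quadratic_ext (vL : L -> int) (e : nat) : Prop := QuadraticExt {
  quad_dim : \dim {:L} = 2%N;
  quad_val : normalized_valuation vL;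
  quad_ram : forall a : F, a != 0 -> vL (a%:A) = e%:Z * v a }.

(* trace of the F-linear map "multiplication by x" *)
Definition field_trace (x : L) : F :=
  \sum_(i < \dim {:L}) coord (vbasis {:L}) i (x * (vbasis {:L})`_i).

Definition trivial_on_base (R : realType) (nu : L -> R[i]) : Prop :=
  forall a : F, a != 0 -> nu (a%:A) = 1.

Definition mx22 (a b c d : F) : 'M[F]_2 :=
  \matrix_(i, j) nth 0 (nth [::] [:: [:: a; b]; [:: c; d]] i) j.

(* x + y s |-> (x, y; y d, x), where s ^+ 2 = d%:A and (1, s) is an F-basis *)
Definition embed (s : L) (d : F) (z : L) : 'M[F]_2 :=
  let x := coord [tuple 1; s] 0 z in
  let y := coord [tuple 1; s] 1 z in
  mx22 x y (y * d) x.

End Quadratic.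

Section Groups.
Variables (F : fieldType) (v : F -> int).
Local Notation M := 'M[F]_2.

Definition GL2_integers : set M :=
  [set g | [/\ g \in unitmx, v (\det g) = 0 & forall i j, ideal_pow v 0 (g i j)]].

Definition K1 (m : nat) : set M :=
  [set g | [/\ GL2_integers g, ideal_pow v m%:Z (g 1 0)
             & ideal_pow v m%:Z (g 1 1 - 1)]].

Definition radical (e : nat) : set M :=
  if (e == 1)%N then [set x | forall i j, ideal_pow v 1 (x i j)]
  else [set x | [/\ ideal_pow v 1 (x 0 0), ideal_pow v 0 (x 0 1),
                    ideal_pow v 1 (x 1 0) & ideal_pow v 1 (x 1 1)]].

(* additive span of the products of m elements of B (only used for m > 0) *)
Definition power_ideal (B : set M) (m : nat) : set M :=
  [set x | exists k (a : 'I_k -> 'I_m -> M),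
     (forall i j, B (a i j)) /\ x = \sum_(i < k) \prod_(j < m) a i j].

Definition Kgrp (e m : nat) : set M :=
  [set 1 + x | x in power_ideal (radical e) m].

End Groups.

Section CompactInduction.
Variables (R : realType) (F : fieldType) (v : F -> int).
Variable V : vectType R[i].
Local Notation M := 'M[F]_2.
Local Notation C := R[i].

Definition is_rep (J : set M) (Lam : M -> 'End(V)) : Prop :=
  Lam 1 = \1%VF /\
  forall g h, J g -> J h -> Lam (g * h) = (Lam g \o Lam h)%VF.

Definition irreducible_rep (J : set M) (Lam : M -> 'End(V)) : Prop :=
  \dim {:V} != 0%N /\
  forall W : {vspace V}, (forall g, J g -> (Lam g @: W <= W)%VS) ->
    W = 0%VS \/ W = {:V}%VS.

(* Functions on GL_2(F) are functions on all matrices that vanish outside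
   GL_2(F). J being open, "compactly supported modulo J" means that the
   support is contained in finitely many cosets J h. *)
Record cInd (J : set M) (Lam : M -> 'End(V)) (f : M -> V) : Prop := CInd {
  cInd_out : forall g, g \notin unitmx -> f g = 0;
  cInd_equiv : forall j g, J j -> g \in unitmx -> f (j * g) = Lam j (f g);
  cInd_smooth : exists m, forall g k, Kgrp v 1 m.+1 k -> f (g * k) = f g;
  cInd_supp : exists s : seq M, forall g, f g != 0 ->
    exists h j, [/\ h \in s, h \in unitmx, J j & g = j * h] }.

Definition right_translate (g : M) (f : M -> V) : M -> V := fun h => f (h * g).

Definition diag_translate (a : F) (f : M -> V) : M -> V :=
  right_translate (mx22 a 0 0 1) f.

Record invariant_inner_product (pi : set (M -> V))
    (ip : (M -> V) -> (M -> V) -> C) : Prop := InvariantInnerProduct {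
  ip_linear : forall a f f' h, pi f -> pi f' -> pi h ->
    ip (a *: f + f') h = a * ip f h + ip f' h;
  ip_herm : forall f h, pi f -> pi h -> ip h f = ((ip f h)^*)%C;
  ip_pos : forall f, pi f -> f != 0 -> 0 < ip f f;
  ip_inv : forall g f h, g \in unitmx -> pi f -> pi h ->
    ip (right_translate g f) (right_translate g h) = ip f h }.

Definition fixed_by (H : set M) (f : M -> V) : Prop :=
  forall g, H g -> right_translate g f = f.

Definition rep_conductor (pi : set (M -> V)) (c : nat) : Prop :=
  (exists f, [/\ pi f, f != 0 & fixed_by (K1 v c) f]) /\
  forall m f, (m < c)%N -> pi f -> fixed_by (K1 v m) f -> f = 0.

Definition newform (pi : set (M -> V)) (ip : (M -> V) -> (M -> V) -> C)
    (f : M -> V) : Prop :=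
  exists c, [/\ rep_conductor pi c, pi f, fixed_by (K1 v c) f & ip f f = 1].

End CompactInduction.

Section Types.
Variables (R : realType) (F : fieldType) (v : F -> int) (L : fieldExtType F).
Variables (vL : L -> int) (e c : nat) (iota : L -> 'M[F]_2).
Local Notation M := 'M[F]_2.
Local Notation C := R[i].

Definition Lstar : set L := [set l | l != 0].

Definition mul_set (S : set L) (T : set M) : set M :=
  [set g | exists l k, [/\ S l, T k & g = iota l * k]].

Definition grpJ : set M := mul_set Lstar (Kgrp v e c./2).
Definition grpJ1 : set M := mul_set (unit_grp vL 1) (Kgrp v e c./2).
Definition grpH1 : set M := mul_set (unit_grp vL 1) (Kgrp v e (uphalf c)).

(* for c = 2n+1 odd the second factor is K_2(2n+1) = K_2(c) *)
Definition grpB1 : set M :=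
  if odd c then mul_set (unit_grp vL 1) (Kgrp v 2 c) else grpJ.

Variables (theta : L -> C) (psi : F -> C) (alpha : L).

(* tht is given on grpB1 by l (1 + x) |-> theta l * psi (tr (alpha x)) *)
Definition theta_tilde (tht : M -> C) : Prop :=
  forall l x,
    (if odd c then unit_grp vL 1 l else Lstar l) ->
    (if odd c then power_ideal (radical v 2) c x
     else power_ideal (radical v e) c./2 x) ->
    tht (iota l * (1 + x)) = theta l * psi (\tr (iota alpha * x)).

Variable tht : M -> C.

(* Ind_{B^1}^{J^1} tht; smoothness is automatic as J^1 / B^1 is finite *)
Definition ind_space (f : M -> C) : Prop :=
  (forall g, ~ grpJ1 g -> f g = 0) /\
  (forall b g, grpB1 b -> grpJ1 g -> f (b * g) = tht b * f g).

Variables (q : nat) (V : vectType C) (Lam : M -> 'End(V)).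

Definition res_J1_is_ind : Prop :=
  exists T : V -> M -> C,
    [/\ forall a w w' g, T (a *: w + w') g = a * T w g + T w' g,
        injective T,
        forall f, ind_space f <-> exists w, T w = f
      & forall g h w, grpJ1 g -> grpJ1 h -> T (Lam g w) h = T w (h * g)].

(* the restriction to L^* is the direct sum of the theta * nu, each nu with
   c(nu) = 1 and trivial on F^* occurring exactly once *)
Definition res_L_is_sum : Prop :=
  exists (n : nat) (nu : 'I_n -> L -> C) (b : n.-tuple V),
    [/\ basis_of {:V} b,
        forall i, [/\ mult_char vL (nu i), conductor vL (nu i) 1
                    & trivial_on_base (nu i)],
        forall mu, mult_char vL mu -> conductor vL mu 1 -> trivial_on_base mu ->
          exists! i, forall l, l != 0 -> mu l = nu i l
      & forall i l, l != 0 ->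
          Lam (iota l) (tnth b i) = (theta l * nu i l) *: tnth b i].

Definition inducing_rep : Prop :=
  if odd c then
    [/\ is_rep grpJ Lam /\ \dim {:V} = q,
        irreducible_rep grpJ Lam,
        res_J1_is_ind,
        forall h, grpH1 h -> Lam h = tht h *: \1%VF
      & res_L_is_sum]
  else \dim {:V} = 1%N /\ forall g, grpJ g -> Lam g = tht g *: \1%VF.

Definition minimal_vector (pi : set (M -> V)) (ip : (M -> V) -> (M -> V) -> C)
    (f : M -> V) : Prop :=
  [/\ pi f, forall g, grpB1 g -> right_translate g f = tht g *: f & ip f f = 1].

End Types.

(* E with the choice of 0 as default point, needed to build measures on it *)
Definition pointed_ext (F : fieldType) (E : fieldExtType F) : Type := E.
HB.instance Definition _ (F : fieldType) (E : fieldExtType F) :=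
  Choice.copy (pointed_ext E) E.
HB.instance Definition _ (F : fieldType) (E : fieldExtType F) :=
  isPointed.Build (pointed_ext E) (0 : E).

Section Period.
Variables (R : realType) (F : fieldType) (E : fieldExtType F) (vE : E -> int).
Local Notation C := R[i].

Definition Estar : set E := [set t | t != 0].

(* The open subsets of F^* \ E^*, seen as the F^*-saturated open subsets of
   E^*; they generate the Borel sigma-algebra of F^* \ E^*. *)
Definition saturated_open : set (set (pointed_ext E)) :=
  [set A | [/\ A `<=` Estar,
               forall (a : F) (t : E), a != 0 -> A t -> A (a *: t)
             & forall t : E, A t -> exists m, forall u, unit_grp vE m u -> A (t * u)]].

Variable mu : {measure set (g_sigma_algebraType saturated_open) -> \bar R}.

Definition haar_measure : Prop :=
  [/\ forall (t : E) (A : set E), t != 0 -> A `<=` Estar ->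
        saturated_open.-sigma.-measurable A ->
        mu [set t * a | a in A] = mu A,
      (0 < mu Estar)%E & (mu Estar < +oo)%E].

Definition quot_integral (f : E -> C) : C :=
  Complex (\int[mu]_(t in Estar) complex.Re (f t))%R
          (\int[mu]_(t in Estar) complex.Im (f t))%R.

Variables (V : vectType C) (ip : ('M[F]_2 -> V) -> ('M[F]_2 -> V) -> C).
Variables (iotaE : E -> 'M[F]_2) (chi : E -> C).

Definition period (f f' : 'M[F]_2 -> V) : C :=
  quot_integral (fun t => ip (right_translate (iotaE t) f) f' * chi t).

End Period.

(* Main.v *)
Require Import Defs.
From HB Require Import structures.
From mathcomp Require Import all_boot all_order all_algebra all_field.
From mathcomp Require Import all_classical all_reals all_analysis.
From mathcomp.real_closed Require Import complex.
From mathcomp Require Import measurable_realfun zify ring.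
Set Implicit Arguments.
Unset Strict Implicit.
Unset Printing Implicit Defensive.
Import Order.TTheory GRing.Theory Num.Theory.
Local Open Scope classical_set_scope.
Local Open Scope ring_scope.

(* Write P for the mirabolic subgroup of GL_2(F), k = c(theta) / e_L,
   n1 = floor(k / 2), N = ceil(k / 2), and S for the sum of the phi_y over the
   units y modulo varpi^N.

   The period is a positive semi-definite Hermitian form: F^* \ E^* is compact
   and vectors are smooth, so {f, h} is a finite sum, equal up to a positive
   factor to the inner product of the projections of f and h to the
   chi^{-1}-isotypic part.  By Cauchy-Schwarz {phi_y, phi_y} = 0 forces
   {phi_y, phi_y'} = {phi_y', phi_y} = 0, hence the off-diagonal terms vanish.

   It remains to see that the translated newform is a multiple of S.  Since
   L^* acts transitively on the nonzero row vectors, GL_2(F) = L^* P, so an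
   element f of pi is determined by its restriction to P.  If f is invariant
   under diag(O^*, 1), the character psi kills f on upper b * diag(a, 1) unless
   b lies in varpi^n1 O; invariance under the upper unipotent matrices in
   varpi^k O kills f on diag(a, 1) when v(a) < 0, and the element sqrt(D') of
   L^*, which exchanges the two unipotent groups, gives the same when v(a) > 0.
   So f is determined by f(1), which lies in a line.  The vector S has all these
   invariances, and its norm is computed by orthogonality of the phi_y, on which
   the unipotent group acts by distinct characters. *)

(** * Valuations *)

(** For odd c(theta) the representation [Lambda] has dimension q, and nothing obvious confines f(1)
    to a line. Vanishing is therefore tested through one functional [ell] on [V]: evaluation at 1 in
    the model of Lambda|J^1 induced from B^1. Its kernel is large, but J^1 is the product of B^1 and
    the diag(a, 1) in J^1, because L/F is then unramified. So the translates of [ell] by diagonal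
    units in J separate vectors, and they cost nothing for an f invariant under all diagonal units.

    Lower unipotents enter at level n2 = k + v(D') = k + e_L - 1, since conjugation by sqrt(D')
    shifts levels by v(D'); that valuation is forced by the exact conductor of theta. Up to the
    centre, diag(varpi^k, 1) conjugates K1(k + n2) into the group generated by diagonal units, upper
    unipotents of level k and lower ones of level n2. The conductor of pi is never computed: S being
    nonzero bounds it by k + n2, and a newform of smaller level has the same invariances after
    conjugation.

    On the side of E, p != 2 makes 1 and sqrt(D) an orthogonal basis for the valuation, which yields
    the finiteness of E^* modulo F^* U_E(m). *)

Section ValuationTheory.
Variables (K : fieldType) (v : K -> int).
Hypothesis vP : normalized_valuation v.
Local Notation I := (ideal_pow v).

Lemma val_one : v 1 = 0.
Proof.
have := Defs.valM vP (oner_neq0 K) (oner_neq0 K); rewrite mulr1; move: (v 1) => a; lia.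
Qed.

Lemma val_opp x : v (- x) = v x.
Proof.
have n1 : (-1 : K) != 0 by rewrite oppr_eq0 oner_neq0.
have vN1 : v (-1) = 0.
  by have := Defs.valM vP n1 n1; rewrite mulrNN mulr1 val_one; lia.
case: (eqVneq x 0) => [->|x0]; first by rewrite oppr0.
by rewrite -mulN1r Defs.valM // vN1 add0r.
Qed.

Lemma val_inv x : x != 0 -> v x^-1 = - v x.
Proof.
move=> x0; have := Defs.valM vP x0 (invr_neq0 x0).
by rewrite divff // val_one; lia.
Qed.

Lemma val_expr x n : x != 0 -> v (x ^+ n) = n%:Z * v x.
Proof.
move=> x0; elim: n => [|n IHn]; first by rewrite expr0 val_one mul0r.
by rewrite exprS Defs.valM ?expf_neq0 // IHn; lia.
Qed.

Lemma val_exprz x (j : int) : x != 0 -> v (x ^ j) = j * v x.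
Proof.
move=> x0; case: j => n; first by rewrite -exprnP val_expr.
by rewrite NegzE -exprnN val_inv ?expf_neq0 // val_expr //; lia.
Qed.

Lemma ideal0 m : I m 0.
Proof. by left. Qed.

Lemma idealE m x : x != 0 -> I m x <-> m <= v x.
Proof.
move=> x0; split; last by right.
by case=> [x00|//]; rewrite x00 eqxx in x0.
Qed.

Lemma idealW m n x : m <= n -> I n x -> I m x.
Proof. by move=> mn [->|nx]; [left|right; exact: le_trans nx]. Qed.

Lemma idealD m x y : I m x -> I m y -> I m (x + y).
Proof.
have [->|x0] := eqVneq x 0; first by rewrite add0r.
have [->|y0] := eqVneq y 0; first by rewrite addr0.
have [->|xy0] := eqVneq (x + y) 0; first by left.
rewrite !idealE // => mx my; apply: le_trans (Defs.valD vP x0 y0 xy0).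
by rewrite le_min mx my.
Qed.

Lemma idealN m x : I m x -> I m (- x).
Proof.
by case=> [->|mx]; [rewrite oppr0; left|right; rewrite val_opp].
Qed.

Lemma idealB m x y : I m x -> I m y -> I m (x - y).
Proof. by move=> mx my; apply: idealD => //; apply: idealN. Qed.

Lemma idealBC m x y : I m (x - y) -> I m (y - x).
Proof. by rewrite -(opprB x y); exact: idealN. Qed.

Lemma idealM m n x y : I m x -> I n y -> I (m + n) (x * y).
Proof.
have [->|x0] := eqVneq x 0; first by rewrite mul0r; left.
have [->|y0] := eqVneq y 0; first by rewrite mulr0; left.
rewrite !idealE ?mulf_neq0 // Defs.valM //; lia.
Qed.

Lemma ideal0M m x y : I 0 x -> I m y -> I m (x * y).
Proof. by move=> x0 my; rewrite -[m]add0r; exact: idealM. Qed.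

Lemma idealM0 m x y : I m x -> I 0 y -> I m (x * y).
Proof. by move=> mx y0; rewrite -[m]addr0; exact: idealM. Qed.

Lemma idealMV m x y : y != 0 -> I (m + v y) (x * y) <-> I m x.
Proof.
move=> y0; split=> h; last by apply: idealM => //; right.
have -> : x = x * y * y^-1 by rewrite mulfK.
have -> : m = (m + v y) + (- v y) by rewrite addrK.
by apply: idealM => //; right; rewrite val_inv.
Qed.

Lemma ideal_sum m (J : Type) (r : seq J) (P : pred J) (G : J -> K) :
  (forall i, P i -> I m (G i)) -> I m (\sum_(i <- r | P i) G i).
Proof.
by move=> h; elim/big_ind: _ => //; [exact: ideal0|exact: idealD].
Qed.

Lemma ideal_one : I 0 1.
Proof. by right; rewrite val_one. Qed.

Lemma ideal_nat n : I 0 n%:R.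
Proof.
elim: n => [|n IHn]; first exact: ideal0.
by rewrite -addn1 natrD; apply: idealD => //; exact: ideal_one.
Qed.

Lemma not_idealP m x : ~ I m x <-> x != 0 /\ v x < m.
Proof.
have [->|x0] := eqVneq x 0.
  by split=> [h|[//]]; case: h; exact: ideal0.
by rewrite idealE // ltNge; split => [/negP//|[_ /negP]].
Qed.

Lemma val_near x y : x != 0 -> I (v x + 1) (y - x) -> y != 0 /\ v y = v x.
Proof.
move=> x0 h.
have y0 : y != 0.
  apply/negP => /eqP y0; move: h; rewrite y0 sub0r => /idealN.
  by rewrite opprK idealE //; lia.
split=> //.
have vxy : v x <= v y.
  have /(idealE _ y0) // : I (v x) y.
  rewrite -(subrK x y); apply: idealD; first by apply: idealW h; lia.
  by right.
case: (eqVneq (v y) (v x)) => // ne.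
have hy : I (v x + 1) y by right; move: ne vxy; lia.
have := idealB hy h; rewrite subKr idealE //.
lia.
Qed.

Lemma unit_grp0 x : unit_grp v 0 x <-> x != 0 /\ v x = 0.
Proof.
split=> [[]//|[x0 vx]]; split=> //; apply: idealB; first by right; rewrite vx.
exact: ideal_one.
Qed.

Lemma unit_grpW m n x : (m <= n)%N -> unit_grp v n x -> unit_grp v m x.
Proof. by move=> mn [x0 vx h]; split=> //; apply: idealW h; lia. Qed.

Lemma unit_grp1 m : unit_grp v m 1.
Proof. by split; rewrite ?oner_neq0 ?val_one // subrr; left. Qed.

Lemma unit_grp_add1 m u : (0 < m)%N -> I m%:Z u -> unit_grp v m (1 + u).
Proof.
move=> m0 hu.
have [|u0 vu] := @val_near 1 (1 + u) (oner_neq0 _).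
  by rewrite val_one [1 + u]addrC addrK; apply: idealW hu; lia.
by split=> //; rewrite ?vu ?val_one // [1 + u]addrC addrK.
Qed.

Lemma unit_grpM m x y : unit_grp v m x -> unit_grp v m y -> unit_grp v m (x * y).
Proof.
move=> [x0 vx hx] [y0 vy hy]; split; first by rewrite mulf_neq0.
  by rewrite Defs.valM // vx vy.
have -> : x * y - 1 = x * (y - 1) + (x - 1) by ring.
by apply: idealD => //; apply: ideal0M => //; right; rewrite vx.
Qed.

Lemma unit_grpV m x : unit_grp v m x -> unit_grp v m x^-1.
Proof.
move=> [x0 vx hx]; split; first by rewrite invr_neq0.
  by rewrite val_inv // vx.
have -> : x^-1 - 1 = x^-1 * - (x - 1) by field.
by apply: ideal0M; [right; rewrite val_inv // vx|exact: idealN].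
Qed.

End ValuationTheory.

(** * Systems of representatives *)

Section RepresentativeSystem.
Variables (T : Type) (A : set T) (Rel : T -> T -> Prop).
Hypothesis Rsym : forall x y, A x -> A y -> Rel x y -> Rel y x.
Hypothesis Rtrans : forall x y z, A x -> A y -> A z -> Rel x y -> Rel y z -> Rel x z.

(** A quotient is encoded by a relation and a finite family, so that units modulo varpi^N and
    classes of E^* modulo F^* U_E(m) are summed over in the same way. *)
Definition rep_system (I : finType) (r : I -> T) :=
  (forall i, A (r i)) /\ (forall x, A x -> exists! i, Rel x (r i)).

Lemma rep_system_bij (I J : finType) (r : I -> T) (s : J -> T) :
  rep_system r -> rep_system s ->
  exists h : I -> J, bijective h /\ forall i, Rel (r i) (s (h i)).
Proof.
move=> [Ar ur] [As us].
have /choice[h hP] : forall i, exists j, Rel (r i) (s j).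
  by move=> i; have [j [hj _]] := us _ (Ar i); exists j.
have /choice[g gP] : forall j, exists i, Rel (s j) (r i).
  by move=> j; have [i [hi _]] := ur _ (As j); exists i.
exists h; split=> //; exists g => [i|j].
  have [k [_ uk]] := us _ (Ar i); have [l [_ ul]] := ur _ (As (h i)).
  by rewrite -(ul _ (gP _)); apply: ul; exact: Rsym.
have [k [_ uk]] := us _ (As j).
have [l [_ ul]] := us _ (Ar (g j)).
by rewrite -(ul _ (hP _)); apply: ul; exact: Rsym.
Qed.

(** Its use is change of variable: when [r] is a translate of [s], it expresses the invariance of a
    sum over a quotient group. *)
Lemma rep_system_sum (M : nmodType) (f : T -> M) (I J : finType)
    (r : I -> T) (s : J -> T) :
  (forall x y, A x -> A y -> Rel x y -> f x = f y) ->
  rep_system r -> rep_system s -> \sum_i f (r i) = \sum_j f (s j).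
Proof.
move=> fR rP sP; have [h [hbij hR]] := rep_system_bij rP sP.
rewrite [RHS](reindex h) /=; last exact: onW_bij.
by apply: eq_bigr => i _; apply: fR => //; [exact: rP.1|exact: sP.1].
Qed.

Lemma rep_system_of_cover (I : finType) (r : I -> T) :
  (forall i, A (r i)) -> (forall x, A x -> exists i, Rel x (r i)) ->
  exists (J : finType) (s : J -> T), rep_system s.
Proof.
move=> Ar cov.
(* [can] picks one index per class; its fixed points form the system. The default [i] is never
   reached, as the cover applied to [r i] supplies an index. *)
pose can (i : I) := odflt i [pick j | `[< Rel (r i) (r j) >]].
have canR i : Rel (r i) (r (can i)).
  rewrite /can; case: pickP => [j /asboolP //|h] /=.
  by have [j /asboolP] := cov _ (Ar i); rewrite h.
have can_eq i j : Rel (r i) (r j) -> can i = can j.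
  move=> ij; rewrite /can (eq_pick (Q := fun k => `[< Rel (r j) (r k) >])).
    case: pickP => // h.
    by have [k /asboolP] := cov _ (Ar j); rewrite h.
  move=> k; apply/asboolP/asboolP => h.
    by apply: (Rtrans _ _ _ (Rsym _ _ ij) h).
  exact: (Rtrans _ _ _ ij h).
exists {i : I | can i == i}, (fun i => r (val i)); split=> // x Ax.
have [i xi] := cov x Ax.
have ci : can (can i) == can i by apply/eqP/esym/can_eq/canR.
exists (exist _ (can i) ci); split=> /=.
  exact: (Rtrans _ _ _ xi (canR i)).
move=> [j cj] /= xj; apply: val_inj => /=.
rewrite -(eqP cj); apply: can_eq.
by apply: (Rtrans _ _ _ (Rsym _ _ xi) xj).
Qed.

End RepresentativeSystem.

(** * Representatives of integers and units modulo a power of the uniformizer *)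

Section ResidueSystems.
Variables (F : fieldType) (v : F -> int) (p q : nat).
Hypothesis Fp : padic_field v p q.
Variable varpi : F.
Hypotheses (varpi0 : varpi != 0) (v_varpi : v varpi = 1).
Local Notation I := (ideal_pow v).
Let vP := padic_val Fp.

(** Expansion in digits: [r] gives the digit modulo varpi, [z] the n following ones. Only the
    leading digit decides membership in [A], so integers and units are both covered. *)
Lemma rep_system_lift (A : set F) (J J' : finType) (r : J -> F) (z : J' -> F)
    (n : nat) :
  A `<=` I 0 -> (forall x y, A x -> I 1 (y - x) -> A y) ->
  rep_system A (fun x y => I 1 (x - y)) r ->
  rep_system (I 0) (fun x y => I n%:Z (x - y)) z ->
  rep_system A (fun x y => I n.+1%:Z (x - y))
    (fun ij : J * J' => r ij.1 + varpi * z ij.2).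
Proof.
move=> AO Asat [Ar ur] [Oz uz].
have pz x : I 0 x -> I 1 (varpi * x).
  by move=> hx; apply: (idealM0 vP) => //; right; rewrite v_varpi.
have divpi m x y : I m.+1%:Z (x - varpi * y) -> I m%:Z (x / varpi - y).
  move=> h; rewrite -(idealMV vP _ _ varpi0) v_varpi mulrBl divfK //.
  by rewrite [y * _]mulrC; apply: idealW h; lia.
split=> [[i j]|x Ax] /=.
  by apply: (Asat (r i)) => //; rewrite addrC addKr; exact: pz.
have [i [xi ui]] := ur x Ax.
have Ox : I 0 ((x - r i) / varpi).
  by rewrite -(idealMV vP _ _ varpi0) divfK // v_varpi.
have [j [xj uj]] := uz _ Ox.
exists (i, j); split=> /= [|[i' j'] /= h].
  have -> : x - (r i + varpi * z j) = ((x - r i) / varpi - z j) * varpi.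
    by field.
  have -> : n.+1%:Z = n%:Z + v varpi by rewrite v_varpi; lia.
  by rewrite (idealMV vP _ _ varpi0).
have hi : i = i'.
  apply: ui; rewrite -[x - _](subrK (varpi * z j')); apply: (idealD vP).
    by rewrite -addrA -opprD; apply: idealW h; lia.
  exact: pz.
rewrite -hi in h *; congr (_, _); apply: uj; apply: divpi.
by rewrite -addrA -opprD.
Qed.

Lemma rep_system_integers n :
  exists (J : finType) (z : J -> F),
    rep_system (I 0) (fun x y => I n%:Z (x - y)) z /\ #|J| = (q ^ n)%N.
Proof.
elim: n => [|n [J [z [zP cJ]]]].
  exists unit, (fun=> 0); rewrite card_unit expn0; split=> //; split=> [_|x Ox].
    exact: ideal0.
  by exists tt; split=> [|[]//]; rewrite subr0.
have [r [Or ur]] := padic_residue_card Fp.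
exists ('I_q * J)%type, (fun ij => r ij.1 + varpi * z ij.2).
rewrite card_prod card_ord cJ expnS; split=> //.
apply: rep_system_lift => // x y Ox xy.
by rewrite -(subrK x y); apply: (idealD vP) => //; apply: idealW xy.
Qed.

Lemma rep_system_units n : (0 < n)%N ->
  exists (J : finType) (z : J -> F),
    rep_system (unit_grp v 0) (fun x y => I n%:Z (x - y)) z /\
    #|J| = ((q - 1) * q ^ (n - 1))%N.
Proof.
case: n => // n _.
have [J [z [zP cJ]]] := rep_system_integers n.
have [r [Or ur]] := padic_residue_card Fp.
(* [i0] is the class of 0; discarding it leaves the q - 1 leading digits of units. *)
have [i0 [ri0 ui0]] := ur 0 (ideal0 v 0).
rewrite sub0r in ri0; have {}ri0 := idealN vP ri0; rewrite opprK in ri0.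
have unitE x : unit_grp v 0 x <-> I 0 x /\ ~ I 1 x.
  rewrite (unit_grp0 vP); split=> [[x0 vx]|[Ox /not_idealP[x0 vx]]].
    by rewrite !(idealE _ _ x0) vx.
  by split=> //; move: Ox; rewrite (idealE _ _ x0); lia.
pose J1 : finType := {i : 'I_q | i != i0}.
exists (J1 * J)%type, (fun ij => r (val ij.1) + varpi * z ij.2).
split; last first.
  rewrite card_prod cJ !subn1 /=; congr (_ * _)%N.
  rewrite card_sig -[q in RHS]card_ord -(cardC1 i0).
  by apply: eq_card => i; rewrite !inE.
apply: (@rep_system_lift (unit_grp v 0) J1 J (fun i => r (val i)) z n) => //.
- by move=> x /unitE[].
- move=> x y /unitE[Ox nx] xy; apply/unitE; split.
    by rewrite -(subrK x y); apply: (idealD vP) => //; apply: idealW xy.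
  by move=> ny; apply: nx; rewrite -[x](subKr y); apply: (idealB vP).
split=> [[i ii0] /=|x /unitE[Ox nx]].
  apply/unitE; split=> // ri; case/negP: ii0; apply/eqP/esym/ui0.
  by rewrite sub0r; apply: (idealN vP).
have [i [xi ui]] := ur x Ox.
have ii0 : i != i0.
  apply/eqP => ii0; apply: nx; rewrite -(subrK (r i) x); apply: (idealD vP) => //.
  by rewrite ii0.
exists (exist _ i ii0); split=> //= -[j jj0] /= xj; apply: val_inj => /=.
exact: ui.
Qed.

End ResidueSystems.

Lemma padic_two_unit (F : fieldType) (v : F -> int) (p q : nat) :
  padic_field v p q -> p <> 2%N -> (2 : F) != 0 /\ v 2 = 0.
Proof.
move=> Fp p2; have vP := padic_val Fp.
have two0 : (2 : F) != 0.
  apply/negP => h.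
  have := padic_char0 Fp 2; rewrite !inE /= => /negbT.
  by rewrite /= h.
split=> //; apply/eqP; rewrite eq_le.
have := ideal_nat vP 2; rewrite (idealE _ _ two0) => ->; rewrite andbT leNgt.
apply/negP => v2.
(* If 2 were in the maximal ideal, so would be 1 = p - 2 * floor(p / 2), p being odd. *)
have /(idealE _ _ (oner_neq0 F)) : ideal_pow v 1 1.
  have pr := padic_prime Fp.
  have podd : odd p by case: (even_prime pr).
  have -> : (1 : F) = p%:R - 2 * (p./2)%:R.
    by rewrite -{1}(odd_double_half p) podd -mul2n natrD natrM addrK.
  apply: (idealB vP); first exact: padic_residue_char Fp.
  by apply: (idealM0 vP); [right; move: v2; move: (v 2) => a; lia|exact: ideal_nat].
by rewrite (val_one vP).
Qed.

(** * Quadratic extensions and their embeddings *)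

Lemma sum_ord2 (M : nmodType) (f : 'I_2 -> M) : \sum_i f i = f 0 + f 1.
Proof.
rewrite !big_ord_recl big_ord0 addr0; congr (f _ + f _).
exact: val_inj.
Qed.

Lemma mx22E (F : fieldType) (a b c d : F) :
  [/\ mx22 a b c d 0 0 = a, mx22 a b c d 0 1 = b, mx22 a b c d 1 0 = c
    & mx22 a b c d 1 1 = d].
Proof. by split; rewrite mxE. Qed.

Lemma ord2E (i : 'I_2) : i = 0 \/ i = 1.
Proof.
by case: i => [[|[|//]] h]; [left|right]; apply: val_inj.
Qed.

Lemma matrix2P (F : fieldType) (g h : 'M[F]_2) :
  g 0 0 = h 0 0 -> g 0 1 = h 0 1 -> g 1 0 = h 1 0 -> g 1 1 = h 1 1 -> g = h.
Proof.
move=> h00 h01 h10 h11; apply/matrixP => i j.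
by case: (ord2E i) => ->; case: (ord2E j) => ->.
Qed.

Lemma mx22_eta (F : fieldType) (g : 'M[F]_2) :
  g = mx22 (g 0 0) (g 0 1) (g 1 0) (g 1 1).
Proof. by apply: matrix2P; rewrite mxE. Qed.

Lemma mul_mx22 (F : fieldType) (a b c d a' b' c' d' : F) :
  mx22 a b c d * mx22 a' b' c' d' =
  mx22 (a * a' + b * c') (a * b' + b * d') (c * a' + d * c') (c * b' + d * d').
Proof. by apply: matrix2P; rewrite -mulmxE !mxE sum_ord2 !mxE. Qed.

Lemma det_mx22 (F : fieldType) (a b c d : F) : \det (mx22 a b c d) = a * d - b * c.
Proof.
rewrite (expand_det_row _ 0) sum_ord2 /cofactor !det_mx11 !mxE /=.
by rewrite expr0 expr1 mul1r mulN1r mulrN.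
Qed.

Lemma mx22_1 (F : fieldType) : mx22 1 0 0 1 = 1 :> 'M[F]_2.
Proof. by apply: matrix2P; rewrite !mxE. Qed.

Lemma mx22_unit (F : fieldType) (a b c d : F) :
  (mx22 a b c d \in unitmx) = (a * d - b * c != 0).
Proof. by rewrite unitmxE det_mx22 unitfE. Qed.

Section QuadraticExtension.
Variables (F : fieldType) (v : F -> int) (p q : nat).
Hypotheses (Fp : padic_field v p q) (p_neq2 : p <> 2%N).
Variables (E : fieldExtType F) (vE : E -> int) (e : nat).
Hypothesis E_quad : quadratic_ext v vE e.
Variables (s : E) (d : F).
Hypotheses (s2 : s ^+ 2 = d%:A) (sF : forall a : F, s != a%:A).
Local Notation I := (ideal_pow v).
Local Notation IE := (ideal_pow vE).
Let vP := padic_val Fp.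
Let vEP := quad_val E_quad.

Lemma alg_neq0 (a : F) : (a%:A != 0 :> E) = (a != 0).
Proof. by rewrite scaler_eq0 oner_eq0 orbF. Qed.

Lemma quad_free : free [:: 1; s].
Proof.
rewrite free_cons span_seq1 seq1_free.
have s0 : s != 0 by have := sF 0; rewrite scale0r.
rewrite s0 andbT; apply/negP => /vlineP[k hk].
have k0 : k != 0.
  by apply/eqP => k0; move/eqP: hk; rewrite k0 scale0r oner_eq0.
by have /eqP := sF k^-1; rewrite hk scalerA mulVf // scale1r.
Qed.

Lemma quad_coordE (x y : F) :
  coord [tuple 1; s] 0 (x%:A + y *: s) = x /\
  coord [tuple 1; s] 1 (x%:A + y *: s) = y.
Proof.
pose k (i : 'I_2) := if i == 0 then x else y.
have -> : x%:A + y *: s = \sum_(i < 2) k i *: [tuple 1; s]`_i.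
  by rewrite sum_ord2.
by split; rewrite coord_sum_free // quad_free.
Qed.

Lemma quad_decomp (z : E) : exists x y : F, z = x%:A + y *: s.
Proof.
exists (coord [tuple 1; s] 0 z), (coord [tuple 1; s] 1 z).
have bas : basis_of {:E} [tuple 1; s].
  by rewrite basisEfree quad_free subvf (quad_dim E_quad).
by rewrite {1}(coord_basis bas (memvf z)) sum_ord2.
Qed.

Lemma embedE (x y : F) : embed s d (x%:A + y *: s) = mx22 x y (y * d) x.
Proof. by rewrite /embed; have [-> ->] := quad_coordE x y. Qed.

Lemma embed_alg (a : F) : embed s d a%:A = mx22 a 0 0 a.
Proof. by rewrite -[a%:A]addr0 -(scale0r s) embedE mul0r. Qed.

Lemma embedM (z t : E) : embed s d (z * t) = embed s d z * embed s d t.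
Proof.
have [x [y ->]] := quad_decomp z; have [x' [y' ->]] := quad_decomp t.
have -> : (x%:A + y *: s) * (x'%:A + y' *: s) =
    (x * x' + y * y' * d)%:A + (x * y' + y * x') *: s.
  rewrite mulrDl !mulrDr -!scalerAl -!scalerAr !mul1r mulr1 -expr2 s2.
  rewrite !scalerA !scalerDl addrACA [X in _ + X]addrC -!addrA.
  by congr (_ + _); rewrite addrC -!addrA; congr (_ + _); rewrite addrC.
by rewrite !embedE mul_mx22; apply: matrix2P; rewrite !mxE /=; ring.
Qed.

Lemma embed1 : embed s d 1 = 1.
Proof. by rewrite -[1 in LHS]scale1r embed_alg mx22_1. Qed.

Lemma embedV (z : E) : z != 0 -> embed s d z * embed s d z^-1 = 1.
Proof. by move=> z0; rewrite -embedM divff // embed1. Qed.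

Lemma embed_unitmx (z : E) : z != 0 -> embed s d z \in unitmx.
Proof. by move=> z0; have := mulmx1_unit (embedV z0); case. Qed.

End QuadraticExtension.

Lemma algM (F : fieldType) (E : fieldExtType F) (a b : F) :
  (a * b)%:A = a%:A * b%:A :> E.
Proof. by rewrite -scalerAl mul1r scalerA. Qed.

(** * Valuation of x + y s and ramification index *)

Section QuadraticValuation.
Variables (F : fieldType) (v : F -> int) (p q : nat).
Hypotheses (Fp : padic_field v p q) (p_neq2 : p <> 2%N).
Variables (E : fieldExtType F) (vE : E -> int) (e : nat).
Hypothesis E_quad : quadratic_ext v vE e.
Variables (s : E) (d : F).
Hypotheses (s2 : s ^+ 2 = d%:A) (sF : forall a : F, s != a%:A).
Local Notation I := (ideal_pow v).
Local Notation IE := (ideal_pow vE).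
Let vP := padic_val Fp.
Let vEP := quad_val E_quad.

Lemma quad_s_neq0 : s != 0.
Proof. by have := sF 0; rewrite scale0r. Qed.

Lemma quad_d_neq0 : d != 0.
Proof.
by rewrite -(alg_neq0 E) -s2 expf_neq0 // quad_s_neq0.
Qed.

Lemma quad_val_s : 2 * vE s = e%:Z * v d.
Proof.
by rewrite -(quad_ram E_quad) ?quad_d_neq0 // -s2 (val_expr vEP) // quad_s_neq0.
Qed.

(** With e = 0 all nonzero elements of F would have valuation 0 in E. The norm of a uniformizer t
    contradicts this: it is t times the conjugate 2 x - t, which is integral. *)
Lemma quad_e_gt0 : (0 < e)%N.
Proof.
case: (posnP e) => // e0.
have vF a : a != 0 -> vE a%:A = 0 by move=> a0; rewrite (quad_ram E_quad) // e0 mul0r.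
have I0F a : IE 0 a%:A.
  by have [->|a0] := eqVneq a 0; [rewrite scale0r; left|right; rewrite vF].
have [t [t0 vt]] := val_unif vEP.
have [x [y tE]] := quad_decomp E_quad sF t.
have nE : t * ((2 * x)%:A - t) = (x ^+ 2 - y ^+ 2 * d)%:A.
  have ys : (y *: s) ^+ 2 = (y ^+ 2 * d)%:A by rewrite exprZn s2 scalerA.
  have -> : (2 * x)%:A = x%:A + x%:A :> E by rewrite -scalerDl; congr (_ *: _); ring.
  by rewrite scalerBl -ys [x ^+ 2]expr2 algM tE; ring.
have tx : t != (2 * x)%:A.
  apply/eqP => tx; have := vt; rewrite tx vF // -(alg_neq0 E) -tx //.
have n0 : (x ^+ 2 - y ^+ 2 * d) != 0.
  by rewrite -(alg_neq0 E) -nE mulf_neq0 // subr_eq0 eq_sym.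
have : IE 1 (x ^+ 2 - y ^+ 2 * d)%:A.
  rewrite -nE; apply: (idealM0 vEP); first by right; rewrite vt.
  apply: (idealB vEP); first exact: I0F.
  by right; rewrite vt.
by rewrite idealE ?alg_neq0 // vF.
Qed.

Let e0 := quad_e_gt0.

Lemma quad_ideal_alg (m : int) (a : F) : IE (e%:Z * m) a%:A <-> I m a.
Proof.
have [->|a0] := eqVneq a 0.
  by rewrite scale0r; split=> _; exact: ideal0.
rewrite !idealE ?alg_neq0 // (quad_ram E_quad) // ler_pM2l //.
Qed.

(** F is complete, hence closed in E. *)
Lemma quad_approx_base (z : E) :
  (forall m : nat, exists a : F, IE m%:Z (z - a%:A)) -> exists a : F, z = a%:A.
Proof.
move=> h.
have /choice[u uP] : forall m : nat, exists a : F, IE (e%:Z * m%:Z) (z - a%:A).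
  by move=> m; have := h (e * m)%N; rewrite PoszM.
have [|l lP] := padic_complete Fp (u := u).
  move=> m; exists m => i j mi mj.
  rewrite -quad_ideal_alg scalerBl.
  have -> : (u i)%:A - (u j)%:A = (z - (u j)%:A) - (z - (u i)%:A) by ring.
  by apply: (idealB vEP); [apply: idealW (uP j)|apply: idealW (uP i)];
    rewrite ler_pM2l //; lia.
exists l; apply/eqP; rewrite -subr_eq0; apply/negPn/negP => zl.
pose m := `|vE (z - l%:A)|%N.+1.
have [n0 hn0] := lP m.
pose i := maxn n0 m.
have : IE (e%:Z * m%:Z) (z - l%:A).
  rewrite -(subrK (u i)%:A z) -addrA -scalerBl; apply: (idealD vEP).
    by apply: idealW (uP i); rewrite ler_pM2l // /i; lia.
  by rewrite quad_ideal_alg; apply: hn0; rewrite /i; lia.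
rewrite idealE // /m; move: (vE _) => w; nia.
Qed.

(* Newton iteration for X^2 - d in F, run inside E: from an approximation a
   of s, the next one is a + (d - a^2) / (2 a). *)
Lemma quad_unit_residue : v d = 0 -> forall a : F, ~ IE 1 (s - a%:A).
Proof.
move=> vd a sa.
have [two0 v2] := padic_two_unit Fp p_neq2.
have vs : vE s = 0 by have := quad_val_s; rewrite vd mulr0; lia.
have step m (b : F) : IE m.+1%:Z (s - b%:A) ->
    exists b' : F, IE m.+2%:Z (s - b'%:A).
  move=> sb.
  have [|bE0 vbE] := @val_near _ _ vEP s b%:A quad_s_neq0.
    rewrite vs add0r; apply: (idealBC vEP); apply: idealW sb; lia.
  have b0 : b != 0 by rewrite -(alg_neq0 E).
  exists (b + (d - b ^+ 2) / (2 * b)).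
  have c0 : 2 * b != 0 by rewrite mulf_neq0.
  have -> : s - (b + (d - b ^+ 2) / (2 * b))%:A =
            - ((s - b%:A) * (s - b%:A) * ((2 * b)^-1)%:A).
    rewrite scalerDl algM scalerBl -s2 expr2 algM.
    have cc : ((2 * b)^-1)%:A * (b%:A + b%:A) = 1 :> E.
      have -> : b%:A + b%:A = (2 * b)%:A :> E by rewrite -scalerDl; congr (_ *: _); ring.
      by rewrite -algM mulVf // scale1r.
    move: cc; move: (b%:A : E) => B; move: (((2 * b)^-1)%:A : E) => C cc.
    have -> : s - (B + (s ^+ 2 - B * B) * C) =
      s * (1 - C * (B + B)) - B * (1 - C * (B + B)) - (s - B) * (s - B) * C by ring.
    by rewrite cc; ring.
  apply: (idealN vEP); apply: (idealM0 vEP); last first.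
    right; rewrite (quad_ram E_quad) ?invr_neq0 // (val_inv vP) //.
    rewrite (Defs.valM vP) // v2.
    have : vE b%:A = 0 by rewrite vbE.
    by rewrite (quad_ram E_quad) //; lia.
  by apply: idealW (idealM vEP sb sb); lia.
have app m : exists b : F, IE m.+1%:Z (s - b%:A).
  elim: m => [|m [b hb]]; [by exists a|exact: step hb].
have [|b sb] := @quad_approx_base s.
  by move=> m; have [b hb] := app m; exists b; apply: idealW hb; lia.
by have := sF b; rewrite sb eqxx.
Qed.

(** No cancellation occurs in x + y s. If v d = 0, cancellation would make s congruent to -x/y
    modulo the maximal ideal, against [quad_unit_residue]. If v d = 1, terms of equal valuation
    would give e (2 (v x - v y) - 1) = 0. *)
Lemma quad_idealE (m : int) (x y : F) : v d = 0 \/ v d = 1 ->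
  IE m (x%:A + y *: s) <-> IE m x%:A /\ IE m (y *: s).
Proof.
move=> vd; split; last by case; exact: (idealD vEP).
move=> h.
suff ys : IE m (y *: s).
  by split=> //; rewrite -[x%:A](addrK (y *: s)); apply: (idealB vEP).
have [->|y0] := eqVneq y 0; first by rewrite scale0r; left.
have ys0 : y *: s != 0 by rewrite scaler_eq0 negb_or y0 quad_s_neq0.
have [x0|x0] := eqVneq x 0; first by move: h; rewrite x0 scale0r add0r.
have vys : vE (y *: s) = e%:Z * v y + vE s.
  rewrite -mulr_algl (Defs.valM vEP) ?alg_neq0 ?quad_s_neq0 //.
  by rewrite (quad_ram E_quad).
have := quad_val_s.
case: vd => vd.
  rewrite vd mulr0 => vs; have {}vs : vE s = 0 by move: vs; lia.
  have [//|/not_idealP[_ lt]] := pselect (IE m (y *: s)).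
  case: (quad_unit_residue vd (a := - (x / y))).
  have -> : s - (- (x / y))%:A = (x%:A + y *: s) * (y^-1)%:A.
    rewrite scaleNr opprK algM addrC mulrDl; congr (_ + _).
    by rewrite -scalerAl -scalerAr mulr1 scalerA divff // scale1r.
  have yV : vE (y^-1)%:A = - (e%:Z * v y).
    by rewrite (quad_ram E_quad) ?invr_neq0 // (val_inv vP) // mulrN.
  have : IE (m + vE (y^-1)%:A) ((x%:A + y *: s) * (y^-1)%:A).
    by apply: (idealM vEP) => //; right.
  apply: idealW; rewrite yV; lia.
rewrite vd mulr1 => vs.
have xE0 : x%:A != 0 :> E by rewrite alg_neq0.
have vx : vE x%:A = e%:Z * v x by rewrite (quad_ram E_quad).
have [lt|ge] := ltP (vE x%:A) (vE (y *: s)).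
  have [|n0 vn] := @val_near _ _ vEP x%:A (x%:A + y *: s) xE0.
    by rewrite [x%:A + _]addrC addrK; right; rewrite lezD1.
  by right; move: h; rewrite idealE // vn => h; exact: le_trans h (ltW lt).
have {}lt : vE (y *: s) < vE x%:A.
  rewrite lt_neqAle ge andbT vx vys; apply/eqP; move: vs e0.
  move: (vE s) (v x) (v y) => a b b' vs ee hh.
  have {hh} : e%:Z * (2 * (b - b') - 1) = 0 by rewrite mulrBr mulr1 -vs mulrCA mulrBr; lia.
  by move/eqP; rewrite mulf_eq0; lia.
have [|n0 vn] := @val_near _ _ vEP (y *: s) (x%:A + y *: s) ys0.
  by rewrite addrK; right; rewrite lezD1.
by right; move: h; rewrite idealE // vn.
Qed.

Lemma quad_ideal_sE (m : int) (y : F) : IE (e%:Z * m + vE s) (y *: s) <-> I m y.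
Proof.
rewrite -mulr_algl (idealMV vEP) ?quad_s_neq0 //.
exact: quad_ideal_alg.
Qed.

(** A uniformizer x + y s needs a term of valuation 1. The terms have valuations e w and e w + vE s;
    were e > 1 + v d, then vE s would be 0 or lie between 2 and e - 1, and none of these values
    would be 1. The equality 2 vE s = e v d settles the rest. *)
Lemma quad_ramE : v d = 0 \/ v d = 1 -> e%:Z = 1 + v d /\ vE s = v d.
Proof.
move=> vd; have vs := quad_val_s.
have [t [t0 vt]] := val_unif vEP.
have [x [y tE]] := quad_decomp E_quad sF t.
have /(quad_idealE _ _ _ vd)[hx hy] : IE 1 (x%:A + y *: s).
  by rewrite -tE; right; rewrite vt.
suff : e%:Z <= 1 + v d by case: vd vs => ->; rewrite ?mulr0 ?mulr1; lia.
rewrite leNgt; apply/negP => e3.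
have e2 : 2 <= e%:Z by case: vd e3 => ->; lia.
have vsb : 0 <= vE s /\ vE s < e%:Z /\ (vE s = 0 \/ 2 <= vE s).
  by case: vd vs e3 => ->; rewrite ?mulr0 ?mulr1; lia.
have int_aux (w a : int) : 0 <= a -> a < e%:Z -> a = 0 \/ 2 <= a ->
    1 <= e%:Z * w + a -> 2 <= e%:Z * w + a.
  move: e2; move: (e%:Z) => f f2 a0 af ha h1.
  have [w0|w1] := leP w (-1).
    have : f * w <= f * (-1) by apply: ler_wpM2l => //; apply: le_trans f2.
    lia.
  have [w00|w2] := eqVneq w 0; first by move: h1; rewrite w00 mulr0; lia.
  have : f * 1 <= f * w by apply: ler_wpM2l; [exact: le_trans f2|lia].
  lia.
have h2x : IE 2 x%:A.
  have [->|x0] := eqVneq x 0; first by rewrite scale0r; left.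
  move: hx; rewrite !idealE ?alg_neq0 // (quad_ram E_quad) // -[_ * v x]addr0.
  by apply: int_aux => //; left.
have h2y : IE 2 (y *: s).
  have [->|y0] := eqVneq y 0; first by rewrite scale0r; left.
  move: hy; rewrite -mulr_algl.
  have a0 : y%:A * s != 0 by rewrite mulf_neq0 ?alg_neq0 ?quad_s_neq0.
  rewrite !idealE // (Defs.valM vEP) ?alg_neq0 ?quad_s_neq0 //.
  by rewrite (quad_ram E_quad) //; apply: int_aux; lia.
have := idealD vEP h2x h2y; rewrite -tE idealE // vt; lia.
Qed.

End QuadraticValuation.

(** * Powers of the radicals *)

Section MatrixGroups.
Variables (F : fieldType) (v : F -> int) (vP : normalized_valuation v).
Variables (varpi : F) (varpi0 : varpi != 0) (v_varpi : v varpi = 1).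
Local Notation M := 'M[F]_2.
Local Notation I := (ideal_pow v).

Lemma power_ideal1_sub m (x : M) i j :
  power_ideal (radical v 1) m x -> I m%:Z (x i j).
Proof.
case=> [n [a [aB ->]]]; rewrite summxE; apply: (ideal_sum vP) => k _.
elim: m a aB i j => [|m IHm] a aB i j.
  rewrite big_ord0 mxE; case: (_ == _); first exact: ideal_one.
  exact: ideal0.
rewrite big_ord_recl -mulmxE mxE; apply: (ideal_sum vP) => l _.
rewrite -[m.+1%:Z]/(1 + m)%:Z PoszD; apply: (idealM vP); first exact: aB.
exact: (IHm (fun k j => a k (lift ord0 j))).
Qed.

Lemma power_ideal_prod (B : set M) m (y P : M) :
  B y -> B P -> power_ideal B m.+1 (y * P ^+ m).
Proof.
move=> By BP; exists 1%N, (fun _ j => if j == 0 :> 'I_m.+1 then y else P).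
split; first by move=> _ j; case: eqP.
rewrite big_ord1 big_ord_recl /=; congr (_ * _).
by rewrite prodr_const card_ord.
Qed.

Lemma power_ideal0 (B : set M) m : power_ideal B m 0.
Proof. by exists 0%N, (fun _ _ => 0); split; [case|rewrite big_ord0]. Qed.

Lemma Kgrp1 e m : Kgrp v e m 1.
Proof. by exists 0; rewrite ?addr0 //; exact: power_ideal0. Qed.

Lemma ideal_divX (n : nat) (m : int) (x : F) :
  I (m + n%:Z) x -> I m (x * varpi ^- n).
Proof.
rewrite -{1}[x](divfK (expf_neq0 n varpi0)).
rewrite -[n%:Z]mulr1 -v_varpi -(val_expr vP) //.
by rewrite (idealMV vP) // expf_neq0.
Qed.

Lemma power_ideal1P m (x : M) :
  (0 < m)%N -> (forall i j, I m%:Z (x i j)) -> power_ideal (radical v 1) m x.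
Proof.
case: m => // m _ h.
have -> : x = varpi ^- m *: x * (varpi%:M) ^+ m.
  rewrite -scalerAl -mulmxE -rmorphXn /= mul_mx_scalar scalerA.
  by rewrite mulVf ?expf_neq0 // scale1r.
apply: power_ideal_prod => i j; rewrite !mxE.
  by rewrite mulrC; apply: ideal_divX; rewrite -[1 + _]/(m.+1%:Z).
case: (_ == _); first by right; rewrite mulr1n v_varpi.
by rewrite mulr0n; left.
Qed.

(** The radical of the Iwahori order is generated by [P], whose square is the scalar varpi. Dividing
    [x] by a power of [P] leaves one factor in the radical; each division exchanges columns, whence
    the alternating rounding of the exponents. *)
Lemma power_ideal2P m (x : M) : (0 < m)%N ->
  I (uphalf m)%:Z (x 0 0) -> I m./2%:Z (x 0 1) -> I m./2.+1%:Z (x 1 0) ->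
  I (uphalf m)%:Z (x 1 1) -> power_ideal (radical v 2) m x.
Proof.
case: m => // m _ h00 h01 h10 h11.
pose P := mx22 0 1 varpi 0 : M.
have RP : radical v 2 P.
  rewrite /radical /=; have [-> -> -> ->] := mx22E 0 1 varpi (0 : F).
  by split; [left|exact: ideal_one|right; rewrite v_varpi|left].
have P2 j : P ^+ j.*2 = (varpi ^+ j)%:M.
  rewrite -mul2n exprM expr2 mul_mx22 !mul0r !mulr0 mul1r mulr1 !addr0 !add0r.
  have -> : mx22 varpi 0 0 varpi = varpi%:M :> M.
    by apply: matrix2P; rewrite !mxE.
  by rewrite -rmorphXn.
have [m2|m2] := boolP (odd m); last first.
  pose j := m./2.
  have mE : m = j.*2 by rewrite -[LHS](odd_double_half m) (negbTE m2).
  have -> : x = varpi ^- j *: x * P ^+ m.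
    rewrite {1}mE P2 -scalerAl -mulmxE mul_mx_scalar scalerA.
    by rewrite mulVf ?expf_neq0 // scale1r.
  apply: power_ideal_prod => //; rewrite /radical /= !mxE.
  rewrite ![varpi ^- j * _]mulrC.
  split; apply: ideal_divX; [move: h00|move: h01|move: h10|move: h11];
    apply: idealW; rewrite /j; lia.
pose j := m./2.
have mE : m = j.*2.+1 by rewrite -[LHS](odd_double_half m) m2.
pose y := varpi ^- j *: mx22 (x 0 1) (x 0 0 / varpi) (x 1 1) (x 1 0 / varpi) : M.
have -> : x = y * P ^+ m.
  have sc (a : F) (z : M) : z * a%:M = a *: z by rewrite -mulmxE mul_mx_scalar.
  rewrite {1}mE exprSr P2 mulrA sc scalerA.
  rewrite mulfV ?expf_neq0 // scale1r mul_mx22 !mulr0 !mulr1 !addr0 !add0r.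
  by rewrite !divfK //; exact: mx22_eta.
apply: power_ideal_prod => //; rewrite /radical /= !mxE /=.
rewrite ![varpi ^- j * _]mulrC -!(mulrA _ varpi^-1) -invfM -exprS.
split; apply: ideal_divX; [move: h01|move: h00|move: h11|move: h10];
  apply: idealW; rewrite /j; lia.
Qed.

End MatrixGroups.

(** * Compact induction *)

Section CompactInductionTheory.
Variables (R : realType) (F : fieldType) (v : F -> int).
Variable varpi : F.
Hypotheses (vP : normalized_valuation v) (varpi0 : varpi != 0) (v_varpi : v varpi = 1).
Variable V : vectType R[i].
Local Notation M := 'M[F]_2.
Local Notation I := (ideal_pow v).
Implicit Types (f : M -> V) (g h : M).

Lemma right_translateM g h f :
  right_translate g (right_translate h f) = right_translate (g * h) f.
Proof. by apply/funext => x; rewrite /right_translate mulrA. Qed.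

Lemma right_translate1 f : right_translate 1 f = f.
Proof. by apply/funext => x; rewrite /right_translate mulr1. Qed.

Lemma right_translate_lin g (a : R[i]) f f' :
  right_translate g (a *: f + f') = a *: right_translate g f + right_translate g f'.
Proof. by []. Qed.

Lemma right_translate_sum g (J : finType) (G : J -> M -> V) :
  right_translate g (\sum_i G i) = \sum_i right_translate g (G i).
Proof. by apply/funext => x; rewrite /right_translate !fct_sumE. Qed.

Lemma unitmxMr g h : (g * h \in unitmx) = (g \in unitmx) && (h \in unitmx).
Proof. by rewrite -mulmxE unitmx_mul. Qed.

Lemma mx_entries_bounded g : exists n : nat, forall i j, I (- n%:Z) (g i j).
Proof.
exists (\sum_i \sum_j `|v (g i j)|)%N => i j; right.
rewrite (bigD1 i) //= (bigD1 j) //=; lia.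
Qed.

Lemma ideal_mulmx (m n : int) g h :
  (forall i j, I m (g i j)) -> (forall i j, I n (h i j)) ->
  forall i j, I (m + n) ((g * h) i j).
Proof.
move=> hg hh i j; rewrite -mulmxE mxE; apply: (ideal_sum vP) => k _.
exact: (idealM vP).
Qed.

Lemma Kgrp1P m k : Kgrp v 1 m.+1 k <-> forall i j, I m.+1%:Z ((k - 1) i j).
Proof.
split=> [[x hx <-] i j|h]; first by rewrite addrC addKr; apply: power_ideal1_sub hx.
by exists (k - 1); [exact: (power_ideal1P vP varpi0 v_varpi)|rewrite addrC subrK].
Qed.

Lemma Kgrp1W m n k : (m <= n)%N -> Kgrp v 1 n.+1 k -> Kgrp v 1 m.+1 k.
Proof.
by move=> mn /Kgrp1P h; apply/Kgrp1P => i j; apply: idealW (h i j); lia.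
Qed.

Variables (J : set M) (Lam : M -> 'End(V)).
Local Notation pi := (cInd v J Lam).

Lemma cInd0 : pi 0.
Proof.
split=> //; first by move=> j g _ _; rewrite linear0.
  by exists 0%N.
by exists [::] => g; rewrite eqxx.
Qed.

Lemma cInd_lin (a : R[i]) f f' : pi f -> pi f' -> pi (a *: f + f').
Proof.
move=> pf pf'; split.
- move=> g gu; rewrite -[LHS]/(a *: f g + f' g).
  by rewrite (cInd_out pf) // (cInd_out pf') // scaler0 addr0.
- move=> j g Jj gu; rewrite -[LHS]/(a *: f (j * g) + f' (j * g)).
  by rewrite (cInd_equiv pf) // (cInd_equiv pf') // -linearP.
- have [m hm] := cInd_smooth pf; have [m' hm'] := cInd_smooth pf'.
  exists (maxn m m') => g k hk.
  rewrite -[LHS]/(a *: f (g * k) + f' (g * k)) hm ?hm' //; apply: Kgrp1W hk;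
  by rewrite ?leq_maxl ?leq_maxr.
have [s hs] := cInd_supp pf; have [s' hs'] := cInd_supp pf'.
exists (s ++ s') => g.
have [f0|f0 _] := eqVneq (f g) 0; last first.
  have [h [j [hin hu Jj gE]]] := hs g f0.
  by exists h, j; rewrite mem_cat hin.
have [f0'|f0' _] := eqVneq (f' g) 0.
  rewrite -[(_ + _) g]/(a *: f g + f' g) f0 f0' scaler0 addr0.
  by rewrite eqxx.
have [h [j [hin hu Jj gE]]] := hs' g f0'.
by exists h, j; rewrite mem_cat hin orbT.
Qed.

Lemma cIndZ (a : R[i]) f : pi f -> pi (a *: f).
Proof. by move=> pf; rewrite -[_ *: _]addr0; apply: cInd_lin => //; exact: cInd0. Qed.

Lemma cInd_sum (I' : finType) (G : I' -> M -> V) :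
  (forall i, pi (G i)) -> pi (\sum_i G i).
Proof.
move=> h; elim/big_ind: _ => //; first exact: cInd0.
by move=> f f' pf pf'; rewrite -[f]scale1r; exact: cInd_lin.
Qed.

Lemma cInd_translate g f : g \in unitmx -> pi f -> pi (right_translate g f).
Proof.
move=> gu pf; split.
- by move=> h hu; apply: (cInd_out pf); rewrite unitmxMr gu andbT.
- move=> j h Jj hu; rewrite /right_translate -mulrA (cInd_equiv pf) //.
  by rewrite unitmxMr hu.
- have [m hm] := cInd_smooth pf.
  have [n hn] := mx_entries_bounded g.
  have [n' hn'] := mx_entries_bounded (invmx g).
  (* [n] and [n'] bound the denominators of g and its inverse, which conjugation of k - 1 by g can
     introduce. *)
  exists (m + n + n')%N => h k /Kgrp1P hk; rewrite /right_translate.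
  have -> : h * k * g = h * g * (invmx g * k * g).
    by rewrite -!mulmxE !mulmxA mulmxK.
  apply: hm; apply/Kgrp1P => i j.
  have -> : invmx g * k * g - 1 = invmx g * (k - 1) * g.
    by rewrite mulrBr mulr1 mulrBl -!mulmxE mulVmx.
  have := ideal_mulmx (ideal_mulmx hn' hk) hn i j.
  by apply: idealW; lia.
have [s hs] := cInd_supp pf.
exists [seq h * invmx g | h <- s] => h /hs[h' [j [h's h'u Jj hE]]].
exists (h' * invmx g), j; split=> //.
- by apply/mapP; exists h'.
- by rewrite unitmxMr h'u unitmx_inv.
by rewrite mulrA -hE -!mulmxE mulmxK.
Qed.

End CompactInductionTheory.

(** * Hermitian forms on the induced representation, for the inner product and for the period *)

Section SesquilinearForm.
Variables (R : realType) (F : fieldType) (v : F -> int).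
Variable varpi : F.
Hypotheses (vP : normalized_valuation v) (varpi0 : varpi != 0) (v_varpi : v varpi = 1).
Variables (V : vectType R[i]) (J : set 'M[F]_2) (Lam : 'M[F]_2 -> 'End(V)).
Local Notation M := 'M[F]_2.
Local Notation pi := (cInd v J Lam).
Variable B : (M -> V) -> (M -> V) -> R[i].
Hypothesis B_linear : forall (a : R[i]) f f' h, pi f -> pi f' -> pi h ->
  B (a *: f + f') h = a * B f h + B f' h.
Hypothesis B_herm : forall f h, pi f -> pi h -> B h f = ((B f h)^*)%C.
Implicit Types f h : M -> V.

Lemma sesq0l h : pi h -> B 0 h = 0.
Proof.
move=> ph; have := B_linear 1 (cInd0 v J Lam) (cInd0 v J Lam) ph.
by rewrite scale1r addr0 mul1r => /eqP; rewrite -subr_eq subrr => /eqP.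
Qed.

Lemma sesqZl a f h : pi f -> pi h -> B (a *: f) h = a * B f h.
Proof.
move=> pf ph; have := B_linear a pf (cInd0 v J Lam) ph.
by rewrite addr0 sesq0l // addr0.
Qed.

Lemma sesqZr a f h : pi f -> pi h -> B h (a *: f) = (a^*)%C * B h f.
Proof.
move=> pf ph; rewrite B_herm //; last exact: (cIndZ vP varpi0 v_varpi).
by rewrite sesqZl // rmorphM /= -B_herm.
Qed.

Lemma sesq_suml (I : finType) (G : I -> M -> V) h :
  (forall i, pi (G i)) -> pi h -> B (\sum_i G i) h = \sum_i B (G i) h.
Proof.
move=> pG ph.
have [] // : pi (\sum_i G i) /\ B (\sum_i G i) h = \sum_i B (G i) h.
elim/big_rec2: _ => [|i x f _ [pf <-]]; first by split; [exact: cInd0|exact: sesq0l].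
rewrite -[G i]scale1r; split; first exact: (cInd_lin vP varpi0 v_varpi).
by rewrite B_linear // mul1r scale1r.
Qed.

Lemma sesq_sumr (I : finType) (G : I -> M -> V) h :
  (forall i, pi (G i)) -> pi h -> B h (\sum_i G i) = \sum_i B h (G i).
Proof.
move=> pG ph; rewrite B_herm //; last exact: (cInd_sum vP varpi0 v_varpi).
rewrite sesq_suml // rmorph_sum /=; apply: eq_bigr => i _.
by rewrite -B_herm.
Qed.

End SesquilinearForm.

(** * Uniqueness of new vectors *)

Section NewVectors.
Variables (R : realType) (F : fieldType) (v : F -> int) (varpi : F).
Hypotheses (vP : normalized_valuation v) (varpi0 : varpi != 0) (v_varpi : v varpi = 1).
Variables (psi : F -> R[i]) (psiP : unramified_add_char v psi).
Variables (V : vectType R[i]) (J : set 'M[F]_2) (Lam : 'M[F]_2 -> 'End(V)).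
Local Notation M := 'M[F]_2.
Local Notation C := R[i].
Local Notation I := (ideal_pow v).
Local Notation pi := (cInd v J Lam).
Local Notation upper b := (mx22 1 b 0 1).
Local Notation lower c := (mx22 1 0 c 1).
Local Notation dg a := (mx22 a 0 0 1).
Local Notation scal a := (mx22 a 0 0 a).
Variables (ell : V -> C) (k N n1 n2 : nat) (d : F).
Hypotheses (kE : k = (n1 + N)%N) (N_gt0 : (0 < N)%N).
Hypotheses (d0 : d != 0) (n2E : n2%:Z = k%:Z + v d).
Hypothesis J_upper : forall b, I n1%:Z b -> J (upper b).
Hypothesis J_dg : forall a, unit_grp v N a -> J (dg a).
Hypothesis J_omega : forall a : F, a != 0 -> J (mx22 0 a (a * d) 0).
Hypothesis J_scal : forall a : F, a != 0 -> J (scal a).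
Hypothesis Lam_scal : forall (a : F) (u : V), a != 0 -> Lam (scal a) u = u.
Hypothesis J_cover : forall g, g \in unitmx ->
  exists (j : M) (a b : F), [/\ J j, a != 0 & g = j * mx22 a b 0 1].
Hypothesis ell_lin : forall a u w, ell (a *: u + w) = a * ell u + ell w.
Hypothesis ell_upper : forall b u, I n1%:Z b ->
  ell (Lam (upper b) u) = psi (b / varpi ^+ k) * ell u.
Hypothesis ell_dg : forall a u, unit_grp v N a -> ell (Lam (dg a) u) = ell u.
(** If [Lambda] is a character, a = 1 already suffices. In the q-dimensional case [ell] has a
    kernel, and it is its orbit under the diagonal units of J that separates vectors. *)
Hypothesis ell_inj : forall u,
  (forall a, unit_grp v 0 a -> J (dg a) -> ell (Lam (dg a) u) = 0) -> u = 0.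
Implicit Types (f : M -> V) (a b c : F).

Lemma dgM a a' : dg a * dg a' = dg (a * a') :> M.
Proof. by rewrite mul_mx22 !mulr0 !mul0r !mul1r !addr0 !add0r. Qed.

Lemma upperD b b' : upper b * upper b' = upper (b + b') :> M.
Proof.
by rewrite mul_mx22 !mulr0 !mul0r !mul1r !mulr1 !addr0 !add0r addrC.
Qed.

Lemma dg_upper a b : dg a * upper b = upper (a * b) * dg a :> M.
Proof. by rewrite !mul_mx22 !mulr0 !mul0r !mul1r !mulr1 !addr0 !add0r. Qed.

Lemma upper_dg a b : upper b * dg a = mx22 a b 0 1 :> M.
Proof. by rewrite !mul_mx22 !mulr0 !mul0r !mul1r !mulr1 !addr0 !add0r. Qed.


Lemma dg_unitmx a : a != 0 -> (dg a : M) \in unitmx.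
Proof. by move=> a0; rewrite mx22_unit mulr1 mulr0 subr0. Qed.

Lemma upper_unitmx b : (upper b : M) \in unitmx.
Proof. by rewrite mx22_unit mulr1 mulr0 subr0 oner_neq0. Qed.

(* These invariances generate the one under the conjugate of K1 (k + n2) by
   diag(varpi ^ k, 1). *)
Record newvec f : Prop := Newvec {
  newvec_pi : pi f;
  newvec_dg : forall u, unit_grp v 0 u -> right_translate (dg u) f = f;
  newvec_upper : forall b, I k%:Z b -> right_translate (upper b) f = f;
  newvec_lower : forall c, I n2%:Z c -> right_translate (lower c) f = f }.

Lemma psi_nontrivial : exists t, [/\ t != 0, -1 <= v t & psi t != 1].
Proof.
have [t [ht tn]] := achar_nontriv psiP.
have t0 : t != 0.
  by apply: contraNneq tn => ->; rewrite (achar_triv psiP) //; exact: ideal0.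
by exists t; split=> //; apply/(idealE _ _ t0).
Qed.

Lemma eigen_eq0 (x : C) t : psi t != 1 -> x = psi t * x -> x = 0.
Proof.
move=> tn /eqP; rewrite -subr_eq0 -{1}[x]mul1r -mulrBl mulf_eq0 subr_eq0.
by rewrite eq_sym (negbTE tn) => /eqP.
Qed.

Lemma newvec_upper_eq0 f a b :
  newvec f -> a != 0 -> ~ I n1%:Z b -> f (upper b * dg a) = 0.
Proof.
move=> nf a0 nb.
have [t [t0 vt tn]] := psi_nontrivial.
(* Testing with [ell_inj] only replaces (a, b) by (u a, u b) for a unit u, which preserves the
   assumptions. *)
suff key a' b' : a' != 0 -> ~ I n1%:Z b' -> ell (f (upper b' * dg a')) = 0.
  apply: ell_inj => u [u0 vu _] Ju.
  rewrite -(cInd_equiv (newvec_pi nf)) //; last first.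
    by rewrite unitmxMr upper_unitmx dg_unitmx.
  rewrite mulrA dg_upper -mulrA dgM; apply: key; first by rewrite mulf_neq0.
  move=> h; apply: nb; have [b0|b0] := eqVneq b 0; first by rewrite b0; left.
  by move: h; rewrite !idealE ?mulf_neq0 // (Defs.valM vP) // vu add0r.
move=> a0' /not_idealP[b0 vb].
have pk0 : varpi ^+ k != 0 by rewrite expf_neq0.
have vpk : v (varpi ^+ k) = k%:Z by rewrite (val_expr vP) // v_varpi mulr1.
(* Chosen so that al b' = b' + t varpi^k: conjugation by diag(al, 1) produces the factor psi t,
   different from 1. Since v b' < n1 and v t >= -1, al lies in 1 + varpi^N O; since N > 0, t varpi^k
   still has level n1. *)
pose al := 1 + t * varpi ^+ k / b'.
have alU : unit_grp v N al.
  apply: (unit_grp_add1 vP) => //; right.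
  rewrite !(Defs.valM vP) ?mulf_neq0 ?invr_neq0 // (val_inv vP) // vpk.
  by move: vb vt; rewrite kE; move: (v b') (v t) => ? ?; lia.
have al0 : unit_grp v 0 al by apply: unit_grpW alU.
have ub : (upper b' * dg a' : M) \in unitmx by rewrite unitmxMr upper_unitmx dg_unitmx.
apply: (eigen_eq0 tn).
rewrite -{1}(ell_dg _ alU) -(cInd_equiv (newvec_pi nf)) //; last exact: J_dg.
rewrite mulrA dg_upper -mulrA dgM [al * a']mulrC -dgM mulrA.
rewrite -[f (_ * dg al)]/(right_translate (dg al) f _) (newvec_dg nf) //.
have -> : al * b' = t * varpi ^+ k + b'.
  by rewrite /al mulrDl mul1r divfK // addrC.
have tk : I n1%:Z (t * varpi ^+ k).
  right; rewrite (Defs.valM vP) // vpk kE.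
  by move: vt; move: (v t) => ?; lia.
rewrite -upperD -mulrA (cInd_equiv (newvec_pi nf)) //; last exact: J_upper.
by rewrite ell_upper // mulfK.
Qed.

Lemma newvec_dg_ell f a :
  newvec f -> a != 0 -> ell (f (dg a)) = 0 -> f (dg a) = 0.
Proof.
move=> nf a0 ha; apply: ell_inj => u uU Ju.
rewrite -(cInd_equiv (newvec_pi nf)) ?dg_unitmx // dgM mulrC -dgM.
by rewrite -[f (_ * _)]/(right_translate (dg u) f _) (newvec_dg nf).
Qed.

Lemma newvec_dg_neg f a : newvec f -> a != 0 -> v a < 0 -> f (dg a) = 0.
Proof.
move=> nf a0 va; apply: newvec_dg_ell => //.
have [t [t0 vt tn]] := psi_nontrivial.
have pk0 : varpi ^+ k != 0 by rewrite expf_neq0.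
have vpk : v (varpi ^+ k) = k%:Z by rewrite (val_expr vP) // v_varpi mulr1.
apply: (eigen_eq0 tn).
(* From v a <= -1 and v t >= -1. Moved to the left of diag(a, 1), this unipotent becomes upper (t
   varpi^k), on which [ell] sees psi t. *)
have bk : I k%:Z (t * varpi ^+ k / a).
  right; rewrite !(Defs.valM vP) ?mulf_neq0 ?invr_neq0 // (val_inv vP) // vpk.
  by move: va vt; move: (v a) (v t) => ? ?; lia.
rewrite -{1}(newvec_upper nf bk) /right_translate dg_upper mulrC divfK //.
have tk : I n1%:Z (t * varpi ^+ k).
  right; rewrite (Defs.valM vP) // vpk kE.
  by move: vt; move: (v t) => ?; lia.
rewrite (cInd_equiv (newvec_pi nf)) ?dg_unitmx //; last exact: J_upper.
by rewrite ell_upper // mulfK.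
Qed.

Lemma cInd_scal f a : pi f -> a != 0 -> right_translate (scal a) f = f.
Proof.
move=> pf a0; apply/funext => g; rewrite /right_translate.
have sc : g * scal a = scal a * g.
  rewrite [g]mx22_eta !mul_mx22 !mulr0 !mul0r !addr0 !add0r.
  by congr (mx22 _ _ _ _); rewrite mulrC.
have [gu|gu] := boolP (g \in unitmx).
  by rewrite sc (cInd_equiv pf) // ?Lam_scal //; exact: J_scal.
by rewrite !(cInd_out pf) // unitmxMr negb_and gu.
Qed.

(** The translating matrix is the image of sqrt(D'). It exchanges upper and lower unipotents up to
    the factor d, which is why the two levels must differ by exactly v d. *)
Lemma newvec_omega f : newvec f -> newvec (right_translate (mx22 0 1 d 0) f).
Proof.
move=> nf; have pf := newvec_pi nf.
have po : pi (right_translate (mx22 0 1 d 0) f).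
  apply: (cInd_translate vP varpi0 v_varpi) => //.
  by rewrite mx22_unit mul0r mul1r sub0r oppr_eq0.
split=> // [u /[dup] uU [u0 _ _]|b hb|c hc]; rewrite right_translateM.
- have -> : dg u * mx22 0 1 d 0 = scal u * (mx22 0 1 d 0 * dg u^-1) :> M.
    by rewrite !mul_mx22; congr (mx22 _ _ _ _); field.
  rewrite -!right_translateM (newvec_dg nf) ?cInd_scal //.
  exact: (unit_grpV vP).
- have -> : upper b * mx22 0 1 d 0 = mx22 0 1 d 0 * lower (b * d) :> M.
    by rewrite !mul_mx22 !mulr0 !mul0r !addr0 !add0r !mul1r !mulr1.
  rewrite -right_translateM (newvec_lower nf) // n2E.
  by rewrite (idealMV vP).
have -> : lower c * mx22 0 1 d 0 = mx22 0 1 d 0 * upper (c / d) :> M.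
  by rewrite !mul_mx22 !mulr0 !mul0r !addr0 !add0r !mul1r !mulr1 mulrC divfK.
rewrite -right_translateM (newvec_upper nf) // -(idealMV vP _ _ d0).
by rewrite divfK // -n2E.
Qed.

Lemma newvec_dg_pos f a : newvec f -> a != 0 -> 0 < v a -> f (dg a) = 0.
Proof.
move=> nf a0 va.
have := newvec_dg_neg (newvec_omega nf) (invr_neq0 a0).
rewrite (val_inv vP) // oppr_lt0 => /(_ va); rewrite /right_translate => h.
(* diag(a, 1) is the image of (a / d) sqrt(D'), an element of J, times diag(a^-1, 1) and the
   exchanging matrix; this carries v a > 0 to the negative case. *)
have -> : dg a = mx22 0 (a / d) (a / d * d) 0 * (dg a^-1 * mx22 0 1 d 0) :> M.
  by rewrite !mul_mx22; congr (mx22 _ _ _ _); field; rewrite ?a0 ?d0.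
rewrite (cInd_equiv (newvec_pi nf)).
- by rewrite h linear0.
- by apply: J_omega; rewrite mulf_neq0 // invr_neq0.
rewrite unitmxMr dg_unitmx ?invr_neq0 //.
by rewrite mx22_unit mul0r mul1r sub0r oppr_eq0.
Qed.

Lemma newvec_eq0 f : newvec f -> ell (f 1) = 0 -> f = 0.
Proof.
move=> nf f1; apply/funext => g.
have [gu|gu] := boolP (g \in unitmx); last exact: (cInd_out (newvec_pi nf)).
have [j [a [b [Jj a0 ->]]]] := J_cover gu.
have fa : f (dg a) = 0.
  have [va|va|va] := ltgtP (v a) 0.
  - exact: newvec_dg_neg.
  - exact: newvec_dg_pos.
  have aU : unit_grp v 0 a by apply/(unit_grp0 vP).
  apply: newvec_dg_ell => //; rewrite -[dg a]mul1r.
  by rewrite -[f (_ * _)]/(right_translate (dg a) f _) (newvec_dg nf).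
rewrite -upper_dg (cInd_equiv (newvec_pi nf)) //; last first.
  by rewrite unitmxMr upper_unitmx dg_unitmx.
have [hb|nb] := pselect (I n1%:Z b); last by rewrite newvec_upper_eq0 // linear0.
rewrite (cInd_equiv (newvec_pi nf)) ?dg_unitmx //; last exact: J_upper.
by rewrite fa !linear0.
Qed.

Lemma newvec_lin (a : C) f f' : newvec f -> newvec f' -> newvec (a *: f + f').
Proof.
move=> nf nf'; split; first by apply: (cInd_lin vP varpi0 v_varpi); exact: newvec_pi.
- by move=> u uU; rewrite right_translate_lin !newvec_dg.
- by move=> b hb; rewrite right_translate_lin !newvec_upper.
- by move=> c hc; rewrite right_translate_lin !newvec_lower.
Qed.

Lemma newvec_unique f f' : newvec f -> newvec f' -> f' != 0 ->
  exists a : C, f = a *: f'.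
Proof.
move=> nf nf' f0'.
have l0 : ell (f' 1) != 0.
  by apply: contraNneq f0' => h; apply/eqP; exact: newvec_eq0.
exists (ell (f 1) / ell (f' 1)); apply/eqP; rewrite -subr_eq0 addrC; apply/eqP.
rewrite -scaleNr; apply: newvec_eq0; first exact: newvec_lin.
rewrite -[(_ + _) 1]/(_ *: f' 1 + f 1) ell_lin mulNr divfK //.
by rewrite addrC subrr.
Qed.

End NewVectors.

(** * The sum of the translated minimal vectors *)

Section TranslatedMinimalVectors.
Variables (R : realType) (F : fieldType) (v : F -> int) (varpi : F).
Hypotheses (vP : normalized_valuation v) (varpi0 : varpi != 0) (v_varpi : v varpi = 1).
Variables (psi : F -> R[i]) (psiP : unramified_add_char v psi).
Variables (V : vectType R[i]) (J : set 'M[F]_2) (Lam : 'M[F]_2 -> 'End(V)).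
Local Notation M := 'M[F]_2.
Local Notation C := R[i].
Local Notation I := (ideal_pow v).
Local Notation pi := (cInd v J Lam).
Local Notation upper b := (mx22 1 b 0 1).
Local Notation lower c := (mx22 1 0 c 1).
Local Notation dg a := (mx22 a 0 0 1).
Local Notation scal a := (mx22 a 0 0 a).
Variables (k N n1 n2 : nat).
Hypotheses (kE : k = (n1 + N)%N) (kn2 : (k <= n2)%N).
Variable ip : (M -> V) -> (M -> V) -> C.
Hypothesis ipP : invariant_inner_product pi ip.
Hypothesis scal_triv : forall f (a : F), pi f -> a != 0 -> right_translate (scal a) f = f.
Local Notation newvec := (newvec v J Lam k n2).
Implicit Types f : M -> V.

Variable phi0 : M -> V.
Hypothesis pi_phi0 : pi phi0.
Hypothesis phi0_upper : forall b, I n1%:Z b ->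
  right_translate (upper b) phi0 = psi (b / varpi ^+ k) *: phi0.
Hypothesis phi0_dg : forall a, unit_grp v N a -> right_translate (dg a) phi0 = phi0.
Hypothesis phi0_lower : forall c, I n2%:Z c -> right_translate (lower c) phi0 = phi0.
Hypothesis phi0_norm : ip phi0 phi0 = 1.
Local Notation phi y := (diag_translate y phi0).

Lemma pi_phi y : y != 0 -> pi (phi y).
Proof. by move=> y0; apply: (cInd_translate vP varpi0 v_varpi) => //; exact: dg_unitmx. Qed.

Lemma phi_eq y y' : unit_grp v 0 y -> unit_grp v 0 y' -> I N%:Z (y - y') ->
  phi y = phi y'.
Proof.
move=> /(unit_grp0 vP)[y0 vy] /(unit_grp0 vP)[y0' vy'] yy.
have -> : y = y' * (y / y') by field.
rewrite /diag_translate -dgM -right_translateM phi0_dg //.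
split; first by rewrite mulf_neq0 // invr_neq0.
  by rewrite (Defs.valM vP) ?invr_neq0 // (val_inv vP) // vy vy' subrr.
have -> : y / y' - 1 = (y - y') / y' by field.
apply: (idealM0 vP) => //; right; by rewrite (val_inv vP) // vy' oppr0.
Qed.

Lemma phi_dg u y : right_translate (dg u) (phi y) = phi (u * y).
Proof. by rewrite /diag_translate right_translateM dgM. Qed.

Lemma phi_upper y b : unit_grp v 0 y -> I n1%:Z b ->
  right_translate (upper b) (phi y) = psi (b / y / varpi ^+ k) *: phi y.
Proof.
move=> /(unit_grp0 vP)[y0 vy] hb; rewrite /diag_translate right_translateM.
have -> : upper b * dg y = dg y * upper (b / y) :> M.
  by rewrite dg_upper mulrC divfK.
rewrite -right_translateM phi0_upper //.
by apply: (idealM0 vP) => //; right; rewrite (val_inv vP) // vy oppr0.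
Qed.

Lemma phi_lower y c : unit_grp v 0 y -> I n2%:Z c ->
  right_translate (lower c) (phi y) = phi y.
Proof.
move=> /(unit_grp0 vP)[y0 vy] hc; rewrite /diag_translate right_translateM.
have -> : lower c * dg y = dg y * lower (c * y) :> M.
  by rewrite !mul_mx22; congr (mx22 _ _ _ _); ring.
rewrite -right_translateM phi0_lower //.
by apply: (idealM0 vP) => //; right; rewrite vy.
Qed.

Lemma phi_norm y : y != 0 -> ip (phi y) (phi y) = 1.
Proof.
by move=> y0; rewrite /diag_translate (ip_inv ipP) //; exact: dg_unitmx.
Qed.

(** [psi] is only given as a homomorphism to nonzero complex numbers; that these values have modulus
    1 comes from the invariance of the norm of [phi0]. *)
Lemma psi_unitary b : I n1%:Z b ->
  psi (b / varpi ^+ k) * ((psi (b / varpi ^+ k))^*)%C = 1.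
Proof.
move=> hb; have := ip_inv ipP (upper_unitmx b) pi_phi0 pi_phi0.
rewrite phi0_upper // (sesqZl (ip_linear ipP)) //; last exact: (cIndZ vP varpi0 v_varpi).
by rewrite (sesqZr vP varpi0 v_varpi (ip_linear ipP) (ip_herm ipP)) // phi0_norm mulr1.
Qed.

Lemma phi_orth y y' : unit_grp v 0 y -> unit_grp v 0 y' -> ~ I N%:Z (y - y') ->
  ip (phi y) (phi y') = 0.
Proof.
move=> yU yU' nyy.
have [y0 vy] := (unit_grp0 vP y).1 yU; have [y0' vy'] := (unit_grp0 vP y').1 yU'.
have [t [t0 vt tn]] := psi_nontrivial psiP.
have [yy0 vyy] := (not_idealP _ _ _).1 nyy.
have pk0 : varpi ^+ k != 0 by rewrite expf_neq0.
have vpk : v (varpi ^+ k) = k%:Z by rewrite (val_expr vP) // v_varpi mulr1.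
(* The solution of b / y - b / y' = t varpi^k, so that the eigenvalues of upper b on the two vectors
   differ by psi t. Its level is n1 because v (y - y') < N. *)
pose b := t * varpi ^+ k * y * y' / (y' - y).
have yy0' : y' - y != 0 by rewrite -opprB oppr_eq0.
have hb : I n1%:Z b.
  right; rewrite !(Defs.valM vP) ?mulf_neq0 ?invr_neq0 //.
  rewrite (val_inv vP) // vy vy' vpk kE -[y' - y]opprB (val_opp vP).
  by move: vt vyy; move: (v t) (v (y - y')) => ? ?; lia.
have hby z : unit_grp v 0 z -> I n1%:Z (b / z).
  move=> /(unit_grp0 vP)[z0 vz]; apply: (idealM0 vP) => //.
  by right; rewrite (val_inv vP) // vz oppr0.
have := ip_inv ipP (upper_unitmx b) (pi_phi y0) (pi_phi y0').
rewrite !phi_upper // (sesqZl (ip_linear ipP))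
  ?(sesqZr vP varpi0 v_varpi (ip_linear ipP) (ip_herm ipP)) //; try exact: pi_phi.
  have e1 : b / y / varpi ^+ k = t + b / y' / varpi ^+ k.
    by rewrite /b; field; rewrite y0 y0' pk0 yy0'.
  have pu := psi_unitary (hby _ yU').
  rewrite e1 (acharD psiP) mulrA -[psi t * _ * _]mulrA pu mulr1.
  by move=> /esym h; apply: (eigen_eq0 tn).
by apply: (cIndZ vP varpi0 v_varpi); exact: pi_phi.
Qed.

Variables (L : finType) (z : L -> F).
Hypothesis zP : rep_system (unit_grp v 0) (fun x y => I N%:Z (x - y)) z.
Local Notation S := (\sum_i phi (z i)).

Let zU i : unit_grp v 0 (z i) := zP.1 i.
Let z0 i : z i != 0.
Proof. by case: (zU i). Qed.

Lemma phi_orth_rep_system i j : i != j -> ip (phi (z i)) (phi (z j)) = 0.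
Proof.
move=> ij; apply: phi_orth => // h; case/negP: ij; apply/eqP.
have [l [_ ul]] := zP.2 _ (zU i).
rewrite -(ul _ h); apply/esym/ul; rewrite subrr; exact: ideal0.
Qed.

Lemma sum_phi_norm : ip S S = #|L|%:R.
Proof.
have pz i : pi (phi (z i)) by exact: pi_phi.
have pS : pi S by exact: (cInd_sum vP varpi0 v_varpi).
rewrite (sesq_suml vP varpi0 v_varpi (ip_linear ipP)) // -sum1_card natr_sum.
apply: eq_bigr => i _; rewrite (sesq_sumr vP varpi0 v_varpi (ip_linear ipP) (ip_herm ipP)) //.
rewrite (bigD1 i) //= phi_norm // big1 ?addr0 // => j ji.
by rewrite phi_orth_rep_system // eq_sym.
Qed.

Lemma newvec_sum_phi : newvec S.
Proof.
have pz i : pi (phi (z i)) by exact: pi_phi.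
split; first exact: (cInd_sum vP varpi0 v_varpi).
- move=> u uU; rewrite right_translate_sum.
  under eq_bigr => i _ do rewrite phi_dg.
  have [u0 vu] := (unit_grp0 vP u).1 uU.
  have uz x : unit_grp v 0 x -> unit_grp v 0 (u * x) by exact: (unit_grpM vP).
  apply: (@rep_system_sum _ (unit_grp v 0) (fun x y => I N%:Z (x - y)) _ _
    (fun y => phi y) _ _ (fun i => u * z i) z) => //.
  + by move=> x y _ _; exact: (idealBC vP).
  + by move=> x y xU yU; exact: phi_eq.
  + split=> [i|x xU]; first exact: uz.
    have [|i [hi ui]] := zP.2 (u^-1 * x).
      by apply: (unit_grpM vP) => //; exact: (unit_grpV vP).
    exists i; split.
      have -> : x - u * z i = u * (u^-1 * x - z i) by field.
      by apply: (ideal0M vP) => //; right; rewrite vu.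
    move=> j hj; apply: ui.
    have -> : u^-1 * x - z j = u^-1 * (x - u * z j) by field.
    by apply: (ideal0M vP) => //; right; rewrite (val_inv vP) // vu oppr0.
- move=> b hb; rewrite right_translate_sum; apply: eq_bigr => i _.
  have [_ vz] := (unit_grp0 vP _).1 (zU i).
  rewrite phi_upper //; last by apply: idealW hb; rewrite kE; lia.
  rewrite (achar_triv psiP) ?scale1r //.
  apply: (ideal_divX vP varpi0 v_varpi).
  by rewrite add0r; apply: (idealM0 vP) => //; right; rewrite (val_inv vP) // vz oppr0.
move=> c hc; rewrite right_translate_sum; apply: eq_bigr => i _.
exact: phi_lower.
Qed.

Lemma sum_phi_neq0 : (0 < #|L|)%N -> S != 0.
Proof.
move=> L0; apply/eqP => S0; have := sum_phi_norm.
rewrite S0 (sesq0l (ip_linear ipP)); last exact: cInd0.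
by move/esym/eqP; rewrite pnatr_eq0; case: #|L| L0.
Qed.

(* The matrices of K1 with positive level factor as scalar * upper * diagonal
   * lower. *)
Lemma newvec_K1 f : (0 < k + n2)%N -> newvec f ->
  fixed_by (K1 v (k + n2)) (diag_translate (varpi ^- k) f).
Proof.
move=> m0 nf g [[gu vdet gO] g10 g11].
have pk0 : varpi ^+ k != 0 by rewrite expf_neq0.
have pk0' : varpi ^- k != 0 by rewrite invr_neq0.
have vpk : v (varpi ^+ k) = k%:Z by rewrite (val_expr vP) // v_varpi mulr1.
have [|e0 ve] := val_near vP (oner_neq0 F) (y := g 1 1).
  by rewrite (val_one vP) add0r; apply: idealW g11; lia.
rewrite (val_one vP) in ve.
move: (gO 0 1) gu vdet g10 g11 e0 ve; rewrite [g]mx22_eta.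
have [_ -> -> ->] := mx22E (g 0 0) (g 0 1) (g 1 0) (g 1 1).
rewrite det_mx22 mx22_unit.
move: (g 0 0) (g 0 1) (g 1 0) (g 1 1) => a b c e hb det0 vdet hc _ e0 ve.
pose u := (a * e - b * c) / e ^+ 2.
have uU : unit_grp v 0 u.
  apply/(unit_grp0 vP); split; first by rewrite mulf_neq0 ?invr_neq0 ?expf_neq0.
  rewrite (Defs.valM vP) ?invr_neq0 ?expf_neq0 // (val_inv vP) ?expf_neq0 //.
  by rewrite (val_expr vP) // ve vdet mulr0 subr0.
rewrite /diag_translate right_translateM.
have -> : mx22 a b c e * dg (varpi ^- k) = dg (varpi ^- k) *
   (scal e * (upper (b / e * varpi ^+ k) * (dg u * lower (c / e / varpi ^+ k)))) :> M.
  by rewrite !mul_mx22 /u; congr (mx22 _ _ _ _); field; rewrite ?e0 ?pk0.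
have eV : I 0 e^-1 by right; rewrite (val_inv vP) // ve oppr0.
rewrite -!right_translateM (newvec_lower nf).
- rewrite (newvec_dg nf) // (newvec_upper nf).
    by rewrite (scal_triv (newvec_pi nf)).
  rewrite -[k%:Z]add0r -vpk; apply: (idealM vP); last by right.
  by rewrite mulrC; exact: (ideal0M vP).
apply: (ideal_divX vP varpi0 v_varpi); apply: (idealM0 vP) => //.
by apply: idealW hc; lia.
Qed.

Lemma K1_newvec c f : (c <= k + n2)%N -> pi f -> fixed_by (K1 v c) f ->
  newvec (diag_translate (varpi ^+ k) f).
Proof.
move=> ck pf fK.
have pk0 : varpi ^+ k != 0 by rewrite expf_neq0.
have vpk : v (varpi ^+ k) = k%:Z by rewrite (val_expr vP) // v_varpi mulr1.
have I0 : I 0 0 by exact: ideal0.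
have I1 : I 0 1 by exact: ideal_one.
have inK a b c' : unit_grp v 0 a -> I 0 b -> I c%:Z c' -> b * c' = 0 ->
    right_translate (mx22 a b c' 1) f = f.
  move=> /(unit_grp0 vP)[a0 va] hb hc bc; apply: fK; split; first split.
  - by rewrite mx22_unit bc subr0 mulr1.
  - by rewrite det_mx22 bc subr0 mulr1.
  - move=> i j; case: (ord2E i) => ->; case: (ord2E j) => ->; rewrite !mxE //=.
      by right; rewrite va.
    by apply: idealW hc.
  - by rewrite mxE.
  by rewrite mxE /= subrr; left.
have U1 : unit_grp v 0 1 by exact: unit_grp1.
split; first by apply: (cInd_translate vP varpi0 v_varpi) => //; exact: dg_unitmx.
- move=> u uU; rewrite right_translateM dgM mulrC -dgM -right_translateM inK //.
    by left.
  by rewrite mul0r.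
- move=> b hb; rewrite right_translateM.
  have -> : upper b * dg (varpi ^+ k) = dg (varpi ^+ k) * upper (b / varpi ^+ k) :> M.
    by rewrite dg_upper mulrC divfK.
  rewrite -right_translateM inK //; last by rewrite mulr0.
    by apply: (ideal_divX vP varpi0 v_varpi); rewrite add0r.
  by left.
move=> c' hc; rewrite right_translateM.
have -> : lower c' * dg (varpi ^+ k) = dg (varpi ^+ k) * lower (c' * varpi ^+ k) :> M.
  by rewrite !mul_mx22; congr (mx22 _ _ _ _); ring.
rewrite -right_translateM inK // ?mul0r //.
have := @idealMV _ _ vP n2%:Z c' _ pk0; rewrite vpk => h.
by apply: idealW (h.2 hc); lia.
Qed.

(* The conductor of pi is at most k + n2 because S is nonzero. *)
Lemma newform_sum_phi f : (0 < k + n2)%N -> (0 < #|L|)%N ->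
  (forall g g', newvec g -> newvec g' -> g' != 0 -> exists a : C, g = a *: g') ->
  newform v pi ip f ->
  exists a : C, diag_translate (varpi ^+ k) f = a *: S /\
    a * (a^*)%C * #|L|%:R = 1.
Proof.
move=> m0 L0 uniq [c [[_ cmin] pf fK fn]].
have S0 := sum_phi_neq0 L0.
have pk0 : varpi ^+ k != 0 by rewrite expf_neq0.
have ck : (c <= k + n2)%N.
  rewrite leqNgt; apply/negP => ck.
  have tS : diag_translate (varpi ^- k) S = 0.
    apply: cmin ck _ (newvec_K1 m0 newvec_sum_phi).
    apply: (cInd_translate vP varpi0 v_varpi).
      by apply: dg_unitmx; rewrite invr_neq0.
    exact: (newvec_pi newvec_sum_phi).
  case/eqP: S0; have : diag_translate (varpi ^+ k) (diag_translate (varpi ^- k) S) = 0.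
    by rewrite tS.
  rewrite /diag_translate right_translateM dgM mulfV //.
  by rewrite mx22_1 right_translate1.
have [a aE] := uniq _ _ (K1_newvec ck pf fK) newvec_sum_phi S0.
exists a; split=> //.
have pS := newvec_pi newvec_sum_phi.
have : ip (diag_translate (varpi ^+ k) f) (diag_translate (varpi ^+ k) f) = 1.
  by rewrite /diag_translate (ip_inv ipP) //; exact: dg_unitmx.
rewrite aE (sesqZl (ip_linear ipP)) //; last exact: (cIndZ vP varpi0 v_varpi).
by rewrite (sesqZr vP varpi0 v_varpi (ip_linear ipP) (ip_herm ipP)) // sum_phi_norm mulrA.
Qed.

End TranslatedMinimalVectors.

(** * The period form *)

(** Measurability of [g] on [D] is automatic: every preimage is a finite union of cells. *)
Lemma Rintegral_step d (T : measurableType d) (R : realType)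
    (mu : {measure set T -> \bar R}) (L : finType) (C : L -> set T) (D : set T)
    (g : T -> R) (x : L -> R) :
  (forall i, measurable (C i)) -> trivIset setT C -> D = \bigcup_i C i ->
  (forall i t, C i t -> g t = x i) -> (forall i, (mu (C i) < +oo)%E) ->
  Rintegral mu D g = \sum_i x i * fine (mu (C i)).
Proof.
move=> mC tC DE gC fC.
have DE' : D = \big[setU/set0]_(i <- enum L) C i.
  rewrite DE -bigcup_seq; apply: eq_bigcupl.
  by split=> i _ //=; rewrite mem_enum.
have mg : measurable_fun D g.
  move=> mD Y mY.
  have -> : D `&` g @^-1` Y = \bigcup_(i in [set i | Y (x i)]) C i.
    rewrite DE; apply/seteqP; split=> [t [[i _ Cit] Yt]|t [i Yi Cit]].
      by exists i => //=; rewrite -(gC _ _ Cit).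
    by split; [exists i|rewrite /= (gC _ _ Cit)].
  exact: fin_bigcup_measurable.
rewrite /Rintegral DE' integral_bigsetU_EFin -?DE' //; last 3 first.
- exact: enum_uniq.
- by apply: sub_trivIset tC.
- exact/measurable_EFinP.
have -> : \sum_i x i * fine (mu (C i)) = \sum_(i <- enum L) x i * fine (mu (C i)).
  by rewrite big_enum.
have -> : (\sum_(i <- enum L) \int[mu]_(t in C i) (g t)%:E)%E =
    (\sum_(i <- enum L) (x i * fine (mu (C i)))%:E)%E.
  apply: eq_bigr => i _.
  rewrite (eq_integral (cst (x i)%:E)); last first.
    by move=> t; rewrite inE => Cit; rewrite (gC _ _ Cit).
  rewrite integral_cst // EFinM fineK // ge0_fin_numE //.
by rewrite sumEFin.
Qed.

Section PeriodGram.
Variables (F : fieldType) (v : F -> int) (p q : nat).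
Hypotheses (Fp : padic_field v p q) (p_neq2 : p <> 2%N).
Variables (varpi : F) (varpi0 : varpi != 0) (v_varpi : v varpi = 1).
Variables (E : fieldExtType F) (vE : E -> int) (e : nat).
Hypothesis E_quad : quadratic_ext v vE e.
Variables (s : E) (d : F).
Hypotheses (s2 : s ^+ 2 = d%:A) (sF : forall a : F, s != a%:A).
Hypothesis vd : v d = 0 \/ v d = 1.
Local Notation I := (ideal_pow v).
Local Notation IE := (ideal_pow vE).
Local Notation M := 'M[F]_2.
Local Notation iota := (embed s d).
Let vP := padic_val Fp.
Let vEP := quad_val E_quad.

(** Equality in the group E^* / F^* U_E(m). For m large enough the integrand of a given period is
    constant on these classes. *)
Definition same_coset (m : nat) (t t' : E) :=
  exists a u, [/\ a != 0 :> F, unit_grp vE m u & t = a *: (t' * u)].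

Lemma scale_neq0 (a : F) (t : E) : a != 0 -> t != 0 -> a *: t != 0.
Proof. by move=> a0 t0; rewrite scaler_eq0 negb_or a0. Qed.

Lemma same_coset_refl m t : same_coset m t t.
Proof.
exists 1, 1; rewrite oner_neq0 mulr1 scale1r; split=> //; exact: unit_grp1.
Qed.

Lemma same_coset_sym m t t' : same_coset m t t' -> same_coset m t' t.
Proof.
move=> [a [u [a0 uU ->]]]; exists a^-1, u^-1; rewrite invr_neq0 //.
split=> //; first exact: (unit_grpV vEP).
have [u0 _ _] := uU.
by rewrite -scalerAl scalerA mulVf // scale1r mulfK.
Qed.

Lemma same_coset_trans m t t' t'' :
  same_coset m t t' -> same_coset m t' t'' -> same_coset m t t''.
Proof.
move=> [a [u [a0 uU ->]]] [a' [u' [a0' uU' ->]]].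
exists (a * a'), (u' * u); rewrite mulf_neq0 //; split=> //.
  exact: (unit_grpM vEP).
by rewrite -scalerAl scalerA mulrA.
Qed.

Lemma same_coset_mul m x t t' : same_coset m t t' -> same_coset m (x * t) (x * t').
Proof.
move=> [a [u [a0 uU ->]]]; exists a, u; split=> //.
by rewrite -scalerAr mulrA.
Qed.

(* A representative of t in F^* \ E^* may be chosen of the form x + s or
   1 + y s with x, y integral, hence of valuation 0 or 1. *)
Lemma quad_primitive (t : E) : t != 0 ->
  exists a x y, [/\ a != 0 :> F, t = a *: (x%:A + y *: s), I 0 x, I 0 y
    & vE (x%:A + y *: s) <= 1].
Proof.
have [eE vs] := quad_ramE Fp p_neq2 E_quad s2 sF vd.
have bound x y : x%:A + y *: s != 0 -> ~ IE (v d + 1) (x%:A + y *: s) ->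
    vE (x%:A + y *: s) <= 1.
  move=> t0 /not_idealP[_]; case: vd => ->; lia.
have [x [y ->]] := quad_decomp E_quad sF t => t0.
have [y0|y0] := eqVneq y 0.
  have x0 : x != 0.
    by apply: contraNneq t0 => x0; rewrite x0 y0 !scale0r addr0.
  exists x, 1, 0; rewrite y0 !scale0r !addr0 scale1r (val_one vEP).
  by split=> //; [exact: ideal_one|left].
have [x0|x0] := boolP ((x == 0) || (v y <= v x)).
  have E1 : x%:A + y *: s = y *: ((x / y)%:A + 1 *: s).
    by rewrite scalerDr scale1r scalerA mulrCA mulfV // mulr1.
  exists y, (x / y), 1; split=> //; last 2 first.
  - exact: ideal_one.
  - apply: bound; first by move: t0; rewrite E1 scaler_eq0 negb_or => /andP[].
    move/(quad_idealE Fp p_neq2 E_quad s2 sF _ _ _ vd)=> [_].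
    rewrite scale1r idealE ?vs ?(quad_s_neq0 sF) //; lia.
  have [->|x1] := eqVneq x 0; first by rewrite mul0r; left.
  right; rewrite (Defs.valM vP) ?invr_neq0 // (val_inv vP) //.
  by move: x0; rewrite (negbTE x1) /=; lia.
move: x0; rewrite negb_or => /andP[x0 vyx].
have E1 : x%:A + y *: s = x *: (1%:A + (y / x) *: s).
  by rewrite scalerDr !scalerA mulr1 mulrCA mulfV // mulr1.
exists x, 1, (y / x); split=> //.
- exact: ideal_one.
- right; rewrite (Defs.valM vP) ?invr_neq0 // (val_inv vP) //; lia.
apply: bound; first by move: t0; rewrite E1 scaler_eq0 negb_or => /andP[].
move/(quad_idealE Fp p_neq2 E_quad s2 sF _ _ _ vd)=> [+ _].
rewrite scale1r idealE ?oner_neq0 // (val_one vEP).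
by case: vd => ->; lia.
Qed.

(** Compactness of F^* \ E^* in finite form: a primitive x + y s has valuation at most 1, so
    rounding x and y to finitely many representatives changes it by a factor in U_E(m). *)
Lemma same_coset_reps m :
  exists (L : finType) (r : L -> E), rep_system (@Estar F E) (same_coset m) r.
Proof.
have [eE vs] := quad_ramE Fp p_neq2 E_quad s2 sF vd.
have e0 := quad_e_gt0 E_quad s2 sF.
(* Two extra digits: the primitive element may have valuation 1, and the rounding error must lie
   strictly above it even when m = 0. *)
have [L [z [[zO zP] _]]] := rep_system_integers Fp varpi0 v_varpi m.+2.
pose r (ij : L * L) := (z ij.1)%:A + z ij.2 *: s.
pose L' : finType := {ij : L * L | r ij != 0}.
apply: (@rep_system_of_cover _ _ _ _ _ L' (fun ij => r (val ij))).
- by move=> x y _ _; exact: same_coset_sym.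
- by move=> x y w _ _ _; exact: same_coset_trans.
- by case.
move=> t t0; have [a [x [y [a0 tE xO yO vt]]]] := quad_primitive t0.
have [i [xi _]] := zP _ xO; have [j [yj _]] := zP _ yO.
set t' := x%:A + y *: s in tE vt.
have t0' : t' != 0 by move: t0; rewrite tE /Estar /= scaler_eq0 negb_or => /andP[].
have near : IE m.+2%:Z (r (i, j) - t').
  have -> : r (i, j) - t' = (z i - x)%:A + (z j - y) *: s.
    by rewrite /r /t' /= !scalerBl; ring.
  have le1 : m.+2%:Z <= e%:Z * m.+2%:Z by rewrite ler_peMl.
  apply: (idealD vEP).
    apply: idealW le1 _; rewrite (quad_ideal_alg E_quad s2 sF).
    exact: (idealBC vP).
  apply: (@idealW _ _ _ (e%:Z * m.+2%:Z + vE s)).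
    by rewrite vs; case: vd => ->; lia.
  rewrite (quad_ideal_sE E_quad s2 sF); exact: (idealBC vP).
have [|r0 vr] := val_near vEP t0' (y := r (i, j)).
  by apply: idealW near; lia.
exists (exist _ (i, j) r0); exists a, (t' / r (i, j)) => /=; split=> //.
  split; first by rewrite mulf_neq0 // invr_neq0.
    by rewrite (Defs.valM vEP) ?invr_neq0 // (val_inv vEP) // vr subrr.
  have -> : t' / r (i, j) - 1 = - (r (i, j) - t') / r (i, j) by field.
  apply: (@idealW _ _ _ (m.+2%:Z - vE t')); first by move: vt; lia.
  apply: (idealM vEP); first exact: (idealN vEP).
  by right; rewrite (val_inv vEP) // vr.
by rewrite mulrC divfK.
Qed.

Variables (R : realType) (chi : E -> R[i]).
Hypotheses (chi_char : mult_char vE chi) (chi_triv : trivial_on_base chi).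
Variable mu : {measure set (g_sigma_algebraType (saturated_open vE)) -> \bar R}.
Hypothesis mu_haar : haar_measure mu.
Variables (V : vectType R[i]) (J : set M) (Lam : M -> 'End(V)).
Local Notation C := R[i].
Local Notation pi := (cInd v J Lam).
Variable ip : (M -> V) -> (M -> V) -> C.
Hypothesis ipP : invariant_inner_product pi ip.
Hypothesis scal_triv : forall f (a : F), pi f -> a != 0 ->
  right_translate (mx22 a 0 0 a) f = f.
Local Notation per := (period mu ip iota chi).

Let coset m t : set (g_sigma_algebraType (saturated_open vE)) :=
  [set t' : E | same_coset m t' t].

Lemma coset_open m t : t != 0 -> saturated_open vE (coset m t).
Proof.
move=> t0; split.
- move=> x [a [u [a0 [u0 _ _] ->]]].
  by apply: scale_neq0 => //; rewrite mulf_neq0.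
- move=> a x a0 [b [u [b0 uU ->]]]; exists (a * b), u; rewrite mulf_neq0 //.
  by split=> //; rewrite scalerA.
move=> x xt; exists m => u uU.
apply: same_coset_trans xt; exists 1, u; rewrite oner_neq0 scale1r.
by split.
Qed.

Lemma coset_measurable m t : t != 0 -> measurable (coset m t).
Proof. by move=> t0; apply: sub_sigma_algebra; exact: coset_open. Qed.

Lemma coset_mu m t : t != 0 -> mu (coset m t) = mu (coset m 1).
Proof.
move=> t0; have [inv _ _] := mu_haar.
rewrite -(inv t (coset m 1)) //.
- congr (mu _); apply/seteqP; split=> [x [a [u [a0 uU ->]]]|_ [x [a [u [a0 uU ->]]] <-]].
    exists (a *: u); first by exists a, u; rewrite mul1r.
    by rewrite -scalerAr.
  by exists a, u; rewrite mul1r -scalerAr.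
- by have [] := coset_open m (oner_neq0 E).
by apply: coset_measurable; exact: oner_neq0.
Qed.

Lemma coset_mu_fin m : (mu (coset m 1) < +oo)%E.
Proof.
have [_ _ fin] := mu_haar; apply: le_lt_trans fin; apply: le_measure.
- by rewrite inE; apply: coset_measurable; exact: oner_neq0.
- rewrite inE; apply: sub_sigma_algebra; split=> //.
    by move=> a t a0 t0; exact: scale_neq0.
  by move=> t t0; exists 0%N => u [u0 _ _]; rewrite /Estar /= mulf_neq0.
by have [] := coset_open m (oner_neq0 E).
Qed.

Lemma quot_integral_sum m (L : finType) (r : L -> E) (f : E -> C) :
  rep_system (@Estar F E) (same_coset m) r ->
  (forall t t', t' != 0 -> same_coset m t t' -> f t = f t') ->
  quot_integral mu f = (Complex (fine (mu (coset m 1))) 0) * \sum_i f (r i).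
Proof.
move=> [r0 rP] fc.
have step (g : E -> R) : (forall t t', t' != 0 -> same_coset m t t' -> g t = g t') ->
    Rintegral mu (@Estar F E) g = \sum_i g (r i) * fine (mu (coset m 1)).
  move=> gc; rewrite (@Rintegral_step _ _ _ mu L (fun i => coset m (r i)) _ _
     (fun i => g (r i))).
  - by apply: eq_bigr => i _; rewrite coset_mu //; exact: r0.
  - by move=> i; apply: coset_measurable; exact: r0.
  - apply/trivIsetP => i j _ _ ij; apply/seteqP; split=> // x [xi xj].
    case/eqP: ij; have [k [_ uk]] := rP _ (r0 i).
    rewrite -(uk i (same_coset_refl _ _)); apply: uk.
    exact: same_coset_trans (same_coset_sym xi) xj.
  - apply/seteqP; split=> [t /rP[i [ti _]]|t [i _ ti]]; first by exists i.
    by have [h _ _] := coset_open m (r0 i); exact: h.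
  - by move=> i t ti; apply: gc => //; exact: r0.
  - by move=> i; rewrite coset_mu ?coset_mu_fin //; exact: r0.
rewrite /quot_integral !step; last 2 first.
- by move=> t t' t0 tt; rewrite (fc _ _ t0 tt).
- by move=> t t' t0 tt; rewrite (fc _ _ t0 tt).
rewrite mulr_sumr; elim/big_rec3: _ => // i a b w _ <-.
case: (f (r i)) => x y; apply/eqP; rewrite eq_complex /=.
by apply/andP; split; apply/eqP; ring.
Qed.

(** For such f, and chi trivial on U_E(m), the vector chi(t) pi(t) f depends only on the class of t,
    so averaging over E^* is a finite sum. *)
Definition stable m (f : M -> V) :=
  pi f /\ forall u, unit_grp vE m u -> right_translate (iota u) f = f.

Lemma stableW m n f : (m <= n)%N -> stable m f -> stable n f.
Proof. by move=> mn [pf h]; split=> // u uU; apply: h; exact: unit_grpW uU. Qed.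

Lemma stable_lin m (a : C) f f' : stable m f -> stable m f' -> stable m (a *: f + f').
Proof.
move=> [pf h] [pf' h']; split; first exact: (cInd_lin vP varpi0 v_varpi).
by move=> u uU; rewrite right_translate_lin h ?h'.
Qed.

Lemma ideal_d : I 0 d.
Proof. by right; case: vd => ->. Qed.

Lemma stable_exists f : pi f -> exists m, stable m f.
Proof.
move=> pf; have [m0 hm] := cInd_smooth pf.
have [eE vs] := quad_ramE Fp p_neq2 E_quad s2 sF vd.
(* The factor e converts valuations of E to those of F; the added 1 absorbs vE s = v d. *)
exists (e * m0.+1 + 1)%N; split=> // u [_ _ hu].
have [x [y uE]] := quad_decomp E_quad sF (u - 1).
have uE' : u = (1 + x)%:A + y *: s.
  by rewrite -[u](subrK 1) uE scalerDl scale1r; ring.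
move: hu; rewrite uE => /(quad_idealE Fp p_neq2 E_quad s2 sF _ _ _ vd)[hx hy].
have Ix : I m0.+1%:Z x.
  by rewrite -(quad_ideal_alg E_quad s2 sF); apply: idealW hx; lia.
have Iy : I m0.+1%:Z y.
  rewrite -(quad_ideal_sE E_quad s2 sF); apply: idealW hy; rewrite vs.
  by case: vd => ->; lia.
apply/funext => g; apply: hm; apply/(Kgrp1P vP varpi0 v_varpi) => i j.
rewrite uE' (embedE _ sF).
case: (ord2E i) => ->; case: (ord2E j) => ->; rewrite !mxE /= ?subr0.
- by rewrite addrC addKr.
- by [].
- by apply: (idealM0 vP) => //; exact: ideal_d.
- by rewrite addrC addKr.
Qed.

Lemma pi_iota t f : t != 0 -> pi f -> pi (right_translate (iota t) f).
Proof.
move=> t0 pf; apply: (cInd_translate vP varpi0 v_varpi) => //.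
exact: (embed_unitmx E_quad s2 sF).
Qed.

(** * Averaging over the finite quotient at a fixed level m *)

Section Level.
Variables (m : nat) (L : finType) (r : L -> E).
Hypothesis chi_m : forall u, unit_grp vE m u -> chi u = 1.
Hypothesis rP : rep_system (@Estar F E) (same_coset m) r.

Let r0 i : r i != 0 := rP.1 i.

Lemma chi_coset t t' : t' != 0 -> same_coset m t t' -> chi t = chi t'.
Proof.
move=> t0 [a [u [a0 uU ->]]]; have [u0 _ _] := uU.
rewrite -mulr_algl (mcharM chi_char) ?alg_neq0 ?mulf_neq0 //.
by rewrite chi_triv // (mcharM chi_char) // (chi_m uU) mul1r mulr1.
Qed.

Lemma rep_system_mul x : x != 0 ->
  rep_system (@Estar F E) (same_coset m) (fun i => x * r i).
Proof.
move=> x0; split=> [i|t t0]; first by rewrite /Estar /= mulf_neq0.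
have xt0 : x^-1 * t != 0 by rewrite mulf_neq0 ?invr_neq0.
have [i [hi ui]] := rP.2 _ xt0; exists i; split.
  by have := same_coset_mul x hi; rewrite mulVKf.
by move=> j hj; apply: ui; have := same_coset_mul x^-1 hj; rewrite mulKf.
Qed.

Lemma sum_rep_mul (N : nmodType) (f : E -> N) x : x != 0 ->
  (forall t t', t' != 0 -> same_coset m t t' -> f t = f t') ->
  \sum_i f (x * r i) = \sum_i f (r i).
Proof.
move=> x0 fc.
apply: (@rep_system_sum _ (@Estar F E) (same_coset m) _ _ f _ _
  (fun i => x * r i) r) => //.
- by move=> t t' _ _; exact: same_coset_sym.
- by move=> t t' _ t0; exact: fc.
exact: rep_system_mul.
Qed.

Lemma card_reps_gt0 : (0 < #|L|)%N.
Proof.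
have [i _] := rP.2 _ (oner_neq0 E).
by apply/card_gt0P; exists i.
Qed.

(** Translation by t permutes the finitely many classes, so the positive sum of the |chi (r i)| is
    multiplied by |chi t| and unchanged. Hence |chi t| = 1. *)
Lemma chi_unitary t : t != 0 -> chi t^-1 = ((chi t)^*)%C.
Proof.
move=> t0; have ct0 := mchar_neq0 chi_char t0.
have n1 : `|chi t| = 1.
  have := @sum_rep_mul _ (fun x => `|chi x|) t t0.
  have -> : \sum_i `|chi (t * r i)| = `|chi t| * \sum_i `|chi (r i)|.
    rewrite mulr_sumr; apply: eq_bigr => i _.
    by rewrite (mcharM chi_char) // normrM.
  move=> /(_ _)/eqP; rewrite -subr_eq0 -[X in _ - X]mul1r -mulrBl mulf_eq0.
  rewrite subr_eq0 => /(_ _)/orP[|/eqP//|/eqP h].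
  - by move=> x x' x0 xx; rewrite (chi_coset x0 xx).
  have [i _] := rP.2 _ (oner_neq0 E).
  have : 0 < \sum_i `|chi (r i)|.
    rewrite (bigD1 i) //= ltr_pwDl //.
      by rewrite normr_gt0 (mchar_neq0 chi_char).
    by apply: sumr_ge0 => j _; exact: normr_ge0.
  by rewrite h ltxx.
have cc : chi t * ((chi t)^*)%C = 1.
  by have := normCK (chi t); rewrite n1 expr1n => <-.
have ci : chi t * chi t^-1 = 1.
  rewrite -(mcharM chi_char) ?invr_neq0 // mulfV //.
  by have := chi_triv (oner_neq0 F); rewrite scale1r.
by apply: (mulfI ct0); rewrite cc ci.
Qed.

(** On vectors stable at level m this is [#|L|] times the projector onto the chi^-1-isotypic
    part. *)
Definition chi_projection (f : M -> V) : M -> V :=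
  \sum_i chi (r i) *: right_translate (iota (r i)) f.

Lemma chi_projection_lin (a : C) f f' :
  chi_projection (a *: f + f') = a *: chi_projection f + chi_projection f'.
Proof.
rewrite /chi_projection scaler_sumr -big_split /=; apply: eq_bigr => i _.
by rewrite right_translate_lin scalerDr scalerA mulrC -scalerA.
Qed.

Lemma pi_chi_projection f : pi f -> pi (chi_projection f).
Proof.
move=> pf; apply: (cInd_sum vP varpi0 v_varpi) => i.
by apply: (cIndZ vP varpi0 v_varpi); exact: pi_iota.
Qed.

(* Since F^* \ E^* is compact, the period is a finite sum over cosets; averaging
   it over translations turns it into an inner product of chi-projections. *)
Lemma period_gram_level f h : stable m f -> stable m h ->
  per f h = (Complex (fine (mu (coset m 1))) 0) * (#|L|%:R)^-1 *
            ip (chi_projection f) (chi_projection h).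
Proof.
move=> [pf sf] [ph _].
pose G t := ip (right_translate (iota t) f) h * chi t.
have Gc t t' : t' != 0 -> same_coset m t t' -> G t = G t'.
  move=> t0 tt; rewrite /G (chi_coset t0 tt); congr (_ * _).
  have [a [u [a0 uU ->]]] := tt.
  rewrite -mulr_algl !(embedM E_quad s2 sF) (embed_alg _ sF).
  rewrite -!right_translateM sf // scal_triv //; exact: pi_iota.
rewrite /period (quot_integral_sum rP Gc) -mulrA; congr (_ * _).
have n0 : (#|L|%:R : C) != 0 by rewrite pnatr_eq0 -lt0n card_reps_gt0.
apply: (mulfI n0); rewrite mulVKf //.
have pt i f' : pi f' -> pi (chi (r i) *: right_translate (iota (r i)) f').
  by move=> pf'; apply: (cIndZ vP varpi0 v_varpi); exact: pi_iota.
rewrite /chi_projection.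
rewrite (sesq_sumr vP varpi0 v_varpi (ip_linear ipP) (ip_herm ipP)) //; last first.
  - exact: pi_chi_projection.
  - by move=> i; exact: pt.
rewrite mulr_natl -sumr_const; apply: eq_bigr => j _.
rewrite (sesq_suml vP varpi0 v_varpi (ip_linear ipP)) //; [|by move=> i; exact: pt|exact: pt].
rewrite -(sum_rep_mul (invr_neq0 (r0 j)) Gc); apply: eq_bigr => i _.
rewrite (sesqZl (ip_linear ipP)) ?(sesqZr vP varpi0 v_varpi (ip_linear ipP) (ip_herm ipP)) //;
  try exact: pi_iota; last by apply: (cIndZ vP varpi0 v_varpi); exact: pi_iota.
rewrite /G (mcharM chi_char) ?invr_neq0 // chi_unitary //.
rewrite mulrC -mulrA mulrCA; congr (_ * (_ * _)).
have uj := embed_unitmx E_quad s2 sF (r0 j).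
rewrite -[LHS](ip_inv ipP uj) //; last first.
  by apply: pi_iota => //; rewrite mulf_neq0 ?invr_neq0.
by rewrite right_translateM -(embedM E_quad s2 sF) mulVKf.
Qed.

End Level.

(** The level depends on the vectors, so a Gram form is available only on a subspace [St] containing
    the given ones. Three vectors are what additivity in the first argument requires. *)
Lemma period_gram (f1 f2 f3 : M -> V) : pi f1 -> pi f2 -> pi f3 ->
  exists (St : set (M -> V)) (P : (M -> V) -> M -> V) (w : R),
    [/\ St f1, St f2, St f3,
        forall (a : C) f f', St f -> St f' -> St (a *: f + f')
      & [/\ forall (a : C) f f', P (a *: f + f') = a *: P f + P f',
        forall f, St f -> pi (P f)
      & forall f h, St f -> St h -> per f h = Complex w 0 * ip (P f) (P h)]].
Proof.
move=> pf1 pf2 pf3.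
have [m1 s1] := stable_exists pf1; have [m2 s2'] := stable_exists pf2.
have [m3 s3] := stable_exists pf3; have [m4 c4] := mchar_smooth chi_char.
pose m := (m1 + m2 + m3 + m4)%N.
have [L [r rP]] := same_coset_reps m.
have chi_m u : unit_grp vE m u -> chi u = 1.
  by move=> uU; apply: c4; apply: unit_grpW uU; rewrite /m; lia.
exists (stable m), (chi_projection r), (fine (mu (coset m 1)) / #|L|%:R).
split; [|apply: stableW s2'|apply: stableW s3|exact: stable_lin|];
  rewrite /m; try lia.
  by apply: stableW s1; lia.
split; first exact: chi_projection_lin.
  by move=> f [pf _]; exact: (pi_chi_projection rP).
move=> f h sf sh; rewrite (period_gram_level chi_m rP) //; congr (_ * _).
have -> : (#|L|%:R : C) = Complex #|L|%:R 0.
  by rewrite -[RHS]/(_%:C)%C rmorph_nat.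
rewrite -[Complex #|L|%:R 0]/((_%:C)%C) -fmorphV.
by apply/eqP; rewrite eq_complex /= !mulr0 !mul0r subr0 addr0 !eqxx.
Qed.

Lemma period_lin (a : C) f f' h : pi f -> pi f' -> pi h ->
  per (a *: f + f') h = a * per f h + per f' h.
Proof.
move=> pf pf' ph.
have [St [P [w [sf sf' sh Sl [Pl Pp perE]]]]] := period_gram pf pf' ph.
rewrite !perE //; last exact: Sl.
by rewrite Pl (ip_linear ipP a (Pp _ sf) (Pp _ sf') (Pp _ sh)); ring.
Qed.

Lemma period_herm f h : pi f -> pi h -> per h f = ((per f h)^*)%C.
Proof.
move=> pf ph.
have [St [P [w [sf sh _ _ [_ Pp perE]]]]] := period_gram pf ph ph.
rewrite !perE // rmorphM /= (ip_herm ipP (Pp _ sf) (Pp _ sh)); congr (_ * _).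
by apply/eqP; rewrite eq_complex /= oppr0 !eqxx.
Qed.

Lemma period_eq0 f h : pi f -> pi h -> per f f = 0 -> per f h = 0.
Proof.
move=> pf ph.
have [St [P [w [sf sh _ _ [_ Pp perE]]]]] := period_gram pf ph ph.
(* Either [w] vanishes, and the form with it, or positivity of [ip] kills [P f]. *)
rewrite !perE // => /eqP; rewrite mulf_eq0 => /orP[/eqP->|/eqP Pf].
  by rewrite mul0r.
have -> : P f = 0.
  apply/eqP; apply/negPn/negP => Pf0.
  by have := ip_pos ipP (Pp _ sf) Pf0; rewrite Pf ltxx.
by rewrite (sesq0l (ip_linear ipP)) ?mulr0 //; exact: Pp.
Qed.

End PeriodGram.

(** * The inducing data *)

(** Rescaling the square root of d by a power of varpi normalizes the valuation of d to 0 or 1, as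
    [quad_ramE] requires. *)
Lemma val_scale_parity (F : fieldType) (v : F -> int) (varpi d : F) :
  normalized_valuation v -> varpi != 0 -> v varpi = 1 -> d != 0 ->
  exists m : int, v (d * varpi ^ (- (m * 2))) = 0 \/ v (d * varpi ^ (- (m * 2))) = 1.
Proof.
move=> vP w0 vw d0; exists (v d %/ 2)%Z.
rewrite (Defs.valM vP) ?expfz_neq0 // (val_exprz vP) // vw mulr1.
have := divz_eq (v d) 2; have := modz_ge0 (v d) (isT : 2 != 0 :> int).
have := ltz_pmod (v d) (isT : 0 < 2 :> int).
move: (v d) => x; move: (x %/ 2)%Z (x %% 2)%Z => a b; lia.
Qed.

(** Here e b + (e - 1) is the valuation of y s with v y = b and s normalized; it reaches e n exactly
    when b >= n. *)
Lemma ramified_level (e n : nat) (b : int) : (e = 1 \/ e = 2)%N ->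
  n%:Z <= b -> (e * n)%N%:Z <= e%:Z * b + (e%:Z - 1).
Proof. by case=> ->; lia. Qed.

Lemma ramified_level_inv (e n : nat) (b : int) : (e = 1 \/ e = 2)%N ->
  (0 < e * n)%N -> (e * n).-1%:Z <= e%:Z * b + (e%:Z - 1) -> n%:Z - 1 <= b.
Proof. by case=> ->; lia. Qed.

Section FieldTrace.
Variables (F : fieldType) (L : fieldExtType F).

Lemma field_traceD (x y : L) : field_trace (x + y) = field_trace x + field_trace y.
Proof.
by rewrite /field_trace -big_split /=; apply: eq_bigr => i _; rewrite mulrDl linearD.
Qed.

Lemma field_traceZ (a : F) (x : L) : field_trace (a *: x) = a * field_trace x.
Proof.
rewrite /field_trace mulr_sumr; apply: eq_bigr => i _.
by rewrite -scalerAl linearZ.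
Qed.

Lemma field_trace1 : field_trace (1 : L) = (\dim {:L})%:R.
Proof.
rewrite /field_trace -[in RHS](card_ord (\dim {:L})) -sum1_card natr_sum.
apply: eq_bigr => i _; rewrite mul1r coord_free ?eqxx //.
exact: basis_free (vbasisP _).
Qed.

End FieldTrace.

(** * The valuation of D' from the conductor of theta *)

Section MinimalElement.
Variables (R : realType) (F : fieldType) (v : F -> int) (p q : nat).
Hypotheses (Fp : padic_field v p q) (p_neq2 : p <> 2%N).
Variables (varpi : F) (varpi0 : varpi != 0) (v_varpi : v varpi = 1).
Variables (psi : F -> R[i]) (psi_char : unramified_add_char v psi).
Variables (L : fieldExtType F) (vL : L -> int) (e : nat).
Hypothesis L_quad : quadratic_ext v vL e.
Variables (theta : L -> R[i]) (c : nat).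
Hypotheses (theta_cond : conductor vL theta c) (c_ge2 : (2 <= c)%N).
Hypothesis c_even : e = 2%N -> ~~ odd c.
Variables (alpha : L) (alpha0 : alpha != 0) (alpha_tr0 : field_trace alpha = 0).
Hypothesis alphaP : forall u, ideal_pow vL (uphalf c)%:Z u ->
  theta (1 + u) = psi (field_trace (alpha * u)).
Variable D' : F.
Hypothesis D'_def : D'%:A = alpha ^- 2 * (varpi%:A) ^- (2 * c %/ e)%N.
Let vP := padic_val Fp.
Let vLP := quad_val L_quad.
Local Notation I := (ideal_pow v).
Local Notation IL := (ideal_pow vL).
Let two := padic_two_unit Fp p_neq2.
Local Notation k := (c %/ e)%N.
Local Notation s := (alpha^-1 * (varpi%:A) ^- k).

Lemma algX (a : F) n : (a ^+ n)%:A = a%:A ^+ n :> L.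
Proof. by rewrite exprZn expr1n. Qed.

Lemma algV (a : F) : (a^-1)%:A = (a%:A)^-1 :> L.
Proof.
have [->|a0] := eqVneq a 0; first by rewrite invr0 scale0r invr0.
have aL0 : a%:A != 0 :> L by rewrite alg_neq0.
by apply: (mulfI aL0); rewrite -algM mulfV // mulfV // scale1r.
Qed.

Lemma alphaV_base a : alpha^-1 != a%:A.
Proof.
have [two0 _] := two; apply/eqP => h.
have aE : alpha = (a^-1)%:A by rewrite algV -h invrK.
have /eqP := alpha_tr0; rewrite aE field_traceZ field_trace1 (quad_dim L_quad).
rewrite mulf_eq0 (negbTE two0) orbF => /eqP a0.
by move: alpha0; rewrite aE a0 scale0r eqxx.
Qed.

(** A multiple [s0] of alpha^-1 by a power varpi^-dl has a square of valuation 0 or 1, which gives e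
    and the valuation of [s0]. As alpha has trace 0, theta (1 + x + y s0) = psi (2 y varpi^-dl) on
    the range of [alphaP]; comparing where the two sides become trivial yields dl = k, so that [s0]
    is the given square root. *)
Lemma minimal_element :
  [/\ (e = 1 \/ e = 2)%N, c = (e * k)%N, s ^+ 2 = D'%:A, forall a : F, s != a%:A
    & v D' = e%:Z - 1].
Proof.
have [two0 v2] := two.
have uc : (uphalf c)%:Z <= c%:Z by lia.
have uc1 : (uphalf c)%:Z <= c.-1%:Z by lia.
have c_gt0 : (0 < c)%N by lia.
have wL0 : varpi%:A != 0 :> L by rewrite alg_neq0.
pose d1 := D' * varpi ^+ (2 * c %/ e)%N.
have d1E : alpha^-1 ^+ 2 = d1%:A.
  by rewrite /d1 algM D'_def algX exprVn mulfVK // expf_neq0.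
have d10 : d1 != 0 by rewrite -(alg_neq0 L) -d1E expf_neq0 // invr_neq0.
have [dl vdl] := val_scale_parity vP varpi0 v_varpi d10.
have wdl0 : varpi ^ (- dl) != 0 by rewrite expfz_neq0.
pose s0 := varpi ^ (- dl) *: alpha^-1.
pose d0 := d1 * varpi ^ (- (dl * 2)).
have s02 : s0 ^+ 2 = d0%:A.
  rewrite /s0 exprZn d1E scalerA mulrC; congr (_ *: _); congr (_ * _).
  by rewrite exprnP exprz_exp mulNr.
have s0F a : s0 != a%:A.
  apply/eqP => h; have /eqP := alphaV_base (a / varpi ^ (- dl)); apply.
  by rewrite mulrC -scalerA -h scalerA mulVf // scale1r.
have [eE vs0] := quad_ramE Fp p_neq2 L_quad s02 s0F vdl.
have e12 : (e = 1 \/ e = 2)%N.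
  by move: eE; case: vdl => ->; rewrite ?addr0 => -[->]; [left|right].
have ck : c = (e * k)%N.
  case: e12 c_even => -> h; first by rewrite mul1n divn1.
  by have := h erefl; rewrite divn2; lia.
have trE x y : field_trace (alpha * (x%:A + y *: s0)) = 2 * (y * varpi ^ (- dl)).
  rewrite mulrDr mulr_algr /s0 scalerA -scalerAr mulfV // field_traceD !field_traceZ.
  by rewrite alpha_tr0 mulr0 add0r field_trace1 (quad_dim L_quad); ring.
have ILy (m : int) y : y != 0 -> IL m (y *: s0) <-> m <= e%:Z * v y + (e%:Z - 1).
  move=> y0; rewrite -mulr_algl idealE; last first.
    by rewrite mulf_neq0 ?alg_neq0 // (quad_s_neq0 s0F).
  rewrite (Defs.valM vLP) ?alg_neq0 ?(quad_s_neq0 s0F) // (quad_ram L_quad) //.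
  by rewrite vs0 -[v d0](addKr 1) -eE [- 1 + _]addrC.
have vw m : v (varpi ^ m) = m by rewrite (val_exprz vP) // v_varpi mulr1.
have dlE : dl = k%:Z.
  (* Minimality of c provides an element of U_L(c - 1) on which theta is nontrivial; its
     s0-coordinate y satisfies k - 1 <= v y < dl. *)
  have [_ /(_ c.-1)[|x [[x0 vx hx] tx]]] := theta_cond; first by rewrite prednK.
  have [x1 [y xE]] := quad_decomp L_quad s0F (x - 1).
  have hup : IL (uphalf c)%:Z (x - 1) by apply: idealW hx.
  have := alphaP hup; rewrite addrC subrK xE trE => th.
  have y0 : y != 0.
    apply: contraNneq tx => y0; rewrite th y0 mul0r mulr0.
    by rewrite (achar_triv psi_char) //; exact: ideal0.
  have vyl : v y - dl < 0.
    rewrite ltNge; apply/negP => vyl; case/eqP: tx; rewrite th.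
    apply: (achar_triv psi_char); right.
    by rewrite !(Defs.valM vP) ?mulf_neq0 // v2 vw add0r.
  have vyk : k%:Z - 1 <= v y.
    move: hx; rewrite xE => /(quad_idealE Fp p_neq2 L_quad s02 s0F _ _ _ vdl)[_].
    by rewrite ILy // {1}ck; apply: ramified_level_inv; rewrite // -ck.
  have kdl : k%:Z <= dl.
    by rewrite -[dl](subrK 1) -lerBlDr; apply: le_trans vyk _; rewrite lerBrDr lezD1 -subr_lt0.
  apply/eqP; rewrite eq_le kdl andbT leNgt; apply/negP => {}kdl.
  have [t [t0 vt tn]] := psi_nontrivial psi_char.
  (* Makes the trace of alpha y1 s0 equal to t. If dl > k, then 1 + y1 s0 would lie in U_L(c), where
     theta is trivial, although psi t != 1. *)
  pose y1 := t / (2 * varpi ^ (- dl)).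
  have c0 : 2 * varpi ^ (- dl) != 0 by rewrite mulf_neq0.
  have y10 : y1 != 0 by rewrite mulf_neq0 ?invr_neq0.
  have vy1 : k%:Z <= v y1.
    rewrite (Defs.valM vP) ?invr_neq0 // (val_inv vP) // (Defs.valM vP) // v2 vw.
    rewrite add0r opprK; move: kdl; rewrite -lezD1 => /(lerD vt).
    by rewrite addrCA subrr addr0.
  have hy1 : IL c%:Z (y1 *: s0).
    by rewrite ILy // {1}ck; exact: ramified_level.
  have := alphaP (idealW uc hy1).
  have -> : alpha * (y1 *: s0) = alpha * (0%:A + y1 *: s0) by rewrite scale0r add0r.
  rewrite trE mulrCA divfK // => h.
  have [tc _] := theta_cond.
  case/eqP: tn; rewrite -h.
  by apply: tc; apply: (unit_grp_add1 vLP).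
have sE : s = s0.
  by rewrite /s0 dlE -exprnN -[RHS]mulr_algl algV algX mulrC.
have d0E : d0 = D'.
  have e_gt0 : (0 < e)%N by case: e12 => ->.
  have -> : d0 = d1 / varpi ^+ (k * 2).
    by rewrite exprnN PoszM /d0 dlE.
  rewrite /d1; have -> : (2 * c %/ e)%N = (k * 2)%N.
    by rewrite {1}ck mulnCA mulKn // mulnC.
  by rewrite mulfK // expf_neq0.
rewrite sE; split=> //; first by rewrite s02 d0E.
by rewrite eE -d0E addrC addKr.
Qed.

End MinimalElement.

Lemma ceil_div_half (e c N : nat) : (e = 1 \/ e = 2)%N -> c = (e * (c %/ e))%N ->
  N = ceil_div c (2 * e) -> N = uphalf (c %/ e).
Proof.
move=> e12 cE ->; rewrite /ceil_div {1}cE; move: (c %/ e)%N => n.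
by case: e12 => ->; lia.
Qed.

Lemma half_uphalf n : n = (n./2 + uphalf n)%N.
Proof. by lia. Qed.

Lemma quotient_gt0 (e c : nat) : (2 <= c)%N -> c = (e * (c %/ e))%N -> (0 < c %/ e)%N.
Proof. by move=> c2 cE; move: c2; rewrite {1}cE; case: (c %/ e)%N => //; rewrite muln0. Qed.

Lemma ramified_n2 (e k : nat) (w : int) : (e = 1 \/ e = 2)%N -> w = e%:Z - 1 ->
  (k + e - 1)%N%:Z = k%:Z + w.
Proof. by move=> e12 ->; case: e12 => ->; lia. Qed.

Lemma leq_ramified (e k : nat) : (e = 1 \/ e = 2)%N -> (k <= k + e - 1)%N.
Proof. by case=> ->; lia. Qed.

Lemma ramified_vd (e : nat) (w : int) : (e = 1 \/ e = 2)%N -> w = e%:Z - 1 ->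
  w = 0 \/ w = 1.
Proof. by move=> e12 ->; case: e12 => ->; [left|right]; lia. Qed.

(** * The inducing groups, their characters and the functional separating vectors *)

Section MinimalTypes.
Variables (R : realType) (F : fieldType) (v : F -> int) (p q : nat).
Hypotheses (Fp : padic_field v p q) (p_neq2 : p <> 2%N).
Variables (varpi : F) (varpi0 : varpi != 0) (v_varpi : v varpi = 1).
Variables (psi : F -> R[i]) (psi_char : unramified_add_char v psi).
Variables (L : fieldExtType F) (vL : L -> int) (e : nat).
Hypothesis L_quad : quadratic_ext v vL e.
Variables (theta : L -> R[i]) (theta_char : mult_char vL theta).
Hypothesis theta_triv : trivial_on_base theta.
Variable c : nat.
Hypotheses (c_ge2 : (2 <= c)%N) (c_even : e = 2%N -> ~~ odd c).
Local Notation k := (c %/ e)%N.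
Hypotheses (e12 : (e = 1 \/ e = 2)%N) (cE : c = (e * k)%N).
Variables (s : L) (d : F).
Hypotheses (s2 : s ^+ 2 = d%:A) (sF : forall a : F, s != a%:A).
Hypothesis vd : v d = e%:Z - 1.
Variable alpha : L.
Hypothesis alpha_s : alpha * s = (varpi ^- k)%:A.
Local Notation M := 'M[F]_2.
Local Notation C := R[i].
Local Notation I := (ideal_pow v).
Local Notation IL := (ideal_pow vL).
Local Notation iota := (embed s d).
Variable tht : M -> C.
Hypothesis tht_def : theta_tilde v vL e c iota theta psi alpha tht.
Variables (V : vectType C) (Lam : M -> 'End(V)).
Hypothesis Lam_def : inducing_rep v vL e c iota theta tht q Lam.
Variable N : nat.
Hypothesis N_def : N = ceil_div c (2 * e).
Let vP := padic_val Fp.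
Let vLP := quad_val L_quad.
Local Notation n1 := (k./2).
Local Notation n2 := (k + e - 1)%N.
Local Notation J := (grpJ v e c iota).
Local Notation B1 := (grpB1 v vL e c iota).
Local Notation upper b := (mx22 1 b 0 1).
Local Notation lower c := (mx22 1 0 c 1).
Local Notation dg a := (mx22 a 0 0 1).
Local Notation scal a := (mx22 a 0 0 a).

Let NE : N = uphalf k := ceil_div_half e12 cE N_def.
Let kE : k = (n1 + N)%N.
Proof. by rewrite NE; exact: half_uphalf. Qed.
Let k_gt0 : (0 < k)%N := quotient_gt0 c_ge2 cE.
Let N_gt0 : (0 < N)%N.
Proof. by rewrite NE; case: k k_gt0. Qed.
Let n2E : n2%:Z = k%:Z + v d := ramified_n2 k e12 vd.
Let vd01 : v d = 0 \/ v d = 1 := ramified_vd e12 vd.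

Lemma d_neq0 : d != 0.
Proof. exact: quad_d_neq0 s2 sF. Qed.

Lemma odd_ramification : odd c -> e = 1%N.
Proof. by move=> oc; case: e12 => // e2; move: (c_even e2); rewrite oc. Qed.

(** A lattice chosen uniformly in the parity of c and in e: 1 + x lies in J, J^1 and B^1 at once.
    The exponent n2 is the one making [tht] trivial on lower unipotents. *)
Definition deep (x : M) :=
  [/\ I N%:Z (x 0 0), I n1%:Z (x 0 1), I n2%:Z (x 1 0) & I N%:Z (x 1 1)].

Lemma deep0 : deep 0.
Proof. by split; rewrite mxE; exact: ideal0. Qed.

Lemma deep_power_ideal x : deep x ->
  power_ideal (radical v e) c./2 x /\ (odd c -> power_ideal (radical v 2) c x).
Proof.
move=> [h00 h01 h10 h11]; split=> [|oc]; last first.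
  have e1 := odd_ramification oc.
  have kc : k = c by rewrite e1 divn1.
  have NE' := NE; rewrite kc e1 in NE' h01 h10.
  apply: (power_ideal2P vP varpi0 v_varpi); first by lia.
  - by rewrite -NE'.
  - by [].
  - by apply: idealW h10; move: oc; lia.
  by rewrite -NE'.
case: e12 c_ge2 => e1; rewrite {1}cE.
  have kc : k = c by rewrite e1 divn1.
  have NE' := NE; rewrite kc e1 in NE' h01 h10 *.
  rewrite mul1n => c2.
  apply: (power_ideal1P vP varpi0 v_varpi) => [|i j]; first by lia.
  case: (ord2E i) => ->; case: (ord2E j) => ->.
  - by apply: idealW h00; lia.
  - by [].
  - by apply: idealW h10; lia.
  - by apply: idealW h11; lia.
have kc : c./2 = k by rewrite e1 divn2.
rewrite [in radical _ e]e1; move: NE h01 h10 k_gt0; rewrite -kc => NE' h01 h10 k0 c2.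
apply: (power_ideal2P vP varpi0 v_varpi); first by lia.
- by rewrite -NE'.
- by [].
- by apply: idealW h10; lia.
by rewrite -NE'.
Qed.

Lemma iota1 : iota 1 = 1. Proof. exact: embed1. Qed.

Lemma deep_J x : deep x -> J (1 + x).
Proof.
move=> /deep_power_ideal[h _]; exists 1, (1 + x); split.
- exact: oner_neq0.
- by exists x.
by rewrite iota1 mul1r.
Qed.

Lemma deep_J1 x : deep x -> grpJ1 v vL e c iota (1 + x).
Proof.
move=> /deep_power_ideal[h _]; exists 1, (1 + x); split.
- exact: unit_grp1.
- by exists x.
by rewrite iota1 mul1r.
Qed.

Lemma deep_B1 x : deep x -> B1 (1 + x).
Proof.
move=> dx; rewrite /grpB1; case: ifP => oc; last exact: deep_J.
have [_ /(_ oc) h] := deep_power_ideal dx.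
exists 1, (1 + x); split; [exact: unit_grp1|by exists x|].
by rewrite iota1 mul1r.
Qed.

Lemma iota_alpha : iota alpha = mx22 0 (varpi ^- k / d) (varpi ^- k) 0.
Proof.
have d0 := d_neq0; have s0 := quad_s_neq0 sF.
have -> : alpha = 0%:A + (varpi ^- k / d) *: s.
  apply: (mulIf s0); rewrite scale0r add0r -scalerAl -expr2 s2 scalerA.
  by rewrite divfK.
by rewrite (embedE _ sF) divfK.
Qed.

(** alpha is an F-multiple of s, so its matrix is antidiagonal and the trace only sees the
    off-diagonal entries of x. *)
Lemma tht_deep x : deep x -> tht (1 + x) = psi ((x 0 1 + x 1 0 / d) / varpi ^+ k).
Proof.
move=> dx; have [h h'] := deep_power_ideal dx.
have t1 : theta 1 = 1.
  by have := theta_triv (oner_neq0 F); rewrite scale1r.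
have := tht_def (l := 1) (x := x); rewrite iota1 mul1r t1 mul1r => ->.
- congr psi; rewrite iota_alpha /mxtrace sum_ord2 -mulmxE !mxE !sum_ord2 !mxE /=.
  by rewrite !mul0r add0r addr0; ring.
- by case: ifP => oc; [exact: unit_grp1|exact: oner_neq0].
by case: ifP => oc; [exact: h'|].
Qed.

Lemma upper_deep b : I n1%:Z b -> exists2 x, deep x & upper b = 1 + x.
Proof.
move=> hb; exists (mx22 0 b 0 0); last by apply: matrix2P; rewrite !mxE /=; ring.
by split; rewrite mxE //; exact: ideal0.
Qed.

Lemma lower_deep b : I n2%:Z b -> exists2 x, deep x & lower b = 1 + x.
Proof.
move=> hb; exists (mx22 0 0 b 0); last by apply: matrix2P; rewrite !mxE /=; ring.
by split; rewrite mxE //; exact: ideal0.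
Qed.

Lemma dg_deep a : unit_grp v N a -> exists2 x, deep x & dg a = 1 + x.
Proof.
move=> [_ _ ha]; exists (mx22 (a - 1) 0 0 0).
  by split; rewrite mxE //; exact: ideal0.
by apply: matrix2P; rewrite !mxE /=; ring.
Qed.

Lemma tht_upper b : I n1%:Z b -> tht (upper b) = psi (b / varpi ^+ k).
Proof.
move=> hb; have -> : upper b = 1 + mx22 0 b 0 0 :> M.
  by apply: matrix2P; rewrite !mxE /=; ring.
rewrite tht_deep; last by split; rewrite mxE //; exact: ideal0.
by rewrite !mxE /= mul0r addr0.
Qed.

Lemma tht_lower b : I n2%:Z b -> tht (lower b) = 1.
Proof.
move=> hb; have -> : lower b = 1 + mx22 0 0 b 0 :> M.
  by apply: matrix2P; rewrite !mxE /=; ring.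
rewrite tht_deep; last by split; rewrite mxE //; exact: ideal0.
rewrite !mxE /= add0r (achar_triv psi_char) //.
apply: (ideal_divX vP varpi0 v_varpi); rewrite add0r.
by rewrite -(idealMV vP _ _ d_neq0) divfK ?d_neq0 // -n2E.
Qed.

Lemma tht_dg a : unit_grp v N a -> tht (dg a) = 1.
Proof.
move=> [_ _ ha]; have -> : dg a = 1 + mx22 (a - 1) 0 0 0 :> M.
  by apply: matrix2P; rewrite !mxE /=; ring.
rewrite tht_deep; last by split; rewrite mxE //; exact: ideal0.
by rewrite !mxE /= mul0r addr0 mul0r (achar_triv psi_char) //; exact: ideal0.
Qed.

Lemma J_iota l : l != 0 -> J (iota l).
Proof. by move=> l0; exists l, 1; rewrite mulr1; split=> //; exact: Kgrp1. Qed.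

Lemma J_scal (a : F) : a != 0 -> J (scal a).
Proof. by move=> a0; rewrite -(embed_alg d sF); apply: J_iota; rewrite alg_neq0. Qed.

Lemma J_omega (a : F) : a != 0 -> J (mx22 0 a (a * d) 0).
Proof.
move=> a0; rewrite -(embedE d sF) scale0r add0r; apply: J_iota.
by rewrite scaler_eq0 negb_or a0 (quad_s_neq0 sF).
Qed.

Lemma J_upper b : I n1%:Z b -> J (upper b).
Proof. by move=> /upper_deep[x dx ->]; exact: deep_J. Qed.

Lemma J_dg a : unit_grp v N a -> J (dg a).
Proof. by move=> /dg_deep[x dx ->]; exact: deep_J. Qed.

Lemma iota_row (x y : F) : (x != 0) || (y != 0) ->
  exists l, [/\ l != 0, iota l 1 0 = x, iota l 1 1 = y & l = y%:A + (x / d) *: s].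
Proof.
move=> xy; have d0 := d_neq0.
pose l := y%:A + (x / d) *: s.
have E1 : iota l = mx22 y (x / d) x y by rewrite (embedE _ sF) divfK.
exists l; split=> //; rewrite ?E1 ?mxE //.
have z0 : iota 0 = mx22 0 0 0 0.
  by rewrite -[0 in LHS](scale0r (1 : L)) (embed_alg d sF).
apply/eqP => l0; move: E1; rewrite l0 z0.
move=> /matrixP h; have := h 1 0; have := h 1 1; rewrite !mxE /= => y0 x0.
by move: xy; rewrite -y0 -x0 eqxx.
Qed.

(* The second row of l g is (0, 1) as soon as l and g^-1 have the same second
   row. *)
Lemma iota_mirabolic (g : M) : g \in unitmx ->
  exists l, [/\ l != 0, l = (invmx g 1 1)%:A + (invmx g 1 0 / d) *: s
    & iota l * g = mx22 ((iota l * g) 0 0) ((iota l * g) 0 1) 0 1].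
Proof.
move=> gu; have hu : invmx g \in unitmx by rewrite unitmx_inv.
have [|l [l0 h10 h11 lE]] := iota_row (x := invmx g 1 0) (y := invmx g 1 1).
  rewrite -negb_and; apply: contraTN hu => /andP[/eqP x0 /eqP y0].
  by rewrite [invmx g]mx22_eta x0 y0 mx22_unit !mulr0 subr0 eqxx.
exists l; split=> //.
have row i : (iota l * g) 1 i = (invmx g * g) 1 i.
  by rewrite -!mulmxE !mxE !sum_ord2 h10 h11.
have gg : invmx g * g = 1 by rewrite -mulmxE mulVmx.
have r0 : (iota l * g) 1 0 = 0 by rewrite row gg mxE.
have r1 : (iota l * g) 1 1 = 1 by rewrite row gg mxE.
by rewrite [LHS]mx22_eta r0 r1.
Qed.

Lemma J_cover (g : M) : g \in unitmx ->
  exists (j : M) (a b : F), [/\ J j, a != 0 & g = j * mx22 a b 0 1].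
Proof.
move=> gu; have [l [l0 _ lg]] := iota_mirabolic gu.
exists (iota l^-1), ((iota l * g) 0 0), ((iota l * g) 0 1); split.
- by apply: J_iota; rewrite invr_neq0.
- have : iota l * g \in unitmx.
    by rewrite unitmxMr gu andbT; exact: (embed_unitmx L_quad s2 sF).
  by rewrite lg mx22_unit mulr1 mulr0 subr0 -lg.
rewrite -lg mulrA -(embedM L_quad s2 sF) mulVf // iota1 mul1r //.
Qed.

(** For odd c, scalars act through the eigenbasis of L^*, with eigenvalues theta nu, both factors
    being trivial on F^*. For even c, [tht] restricts to theta on them. *)
Lemma Lam_scal (a : F) (u : V) : a != 0 -> Lam (scal a) u = u.
Proof.
move=> a0; have aL0 : a%:A != 0 :> L by rewrite alg_neq0.
move: Lam_def; rewrite /inducing_rep; case: ifP => oc.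
  move=> [_ _ _ _ [n [nu [b [bP nuP _ bE]]]]].
  have fixb i : Lam (scal a) (tnth b i) = tnth b i.
    have [_ _ nut] := nuP i.
    by rewrite -(embed_alg d sF) bE // theta_triv // nut // mulr1 scale1r.
  rewrite (coord_basis bP (memvf u)) linear_sum /=; apply: eq_bigr => i _.
  by rewrite linearZ /= -tnth_nth fixb.
move=> [_ LamE]; rewrite LamE; last exact: J_scal.
have := tht_def (l := a%:A) (x := 0); rewrite oc addr0 mulr1 (embed_alg _ sF) => ->.
- by rewrite mulr0 mxtrace0 (achar_triv psi_char) ?theta_triv // ?mulr1 ?scale1r
    ?id_lfunE //; exact: ideal0.
- exact: aL0.
exact: power_ideal0.
Qed.

(** The sum has a single term; writing the coordinate on a line in this way avoids transporting an
    index along the equality of dimensions. *)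
Lemma coord_sum_injective (u : V) : \dim {:V} = 1%N ->
  \sum_i coord (vbasis {:V}) i u = 0 -> u = 0.
Proof.
move=> dV; rewrite {2}(coord_vbasis (memvf u)).
move: (vbasis {:V}); rewrite dV => b; rewrite !big_ord1 => ->.
by rewrite scale0r.
Qed.

(* K_1(n) is contained in U_L(1) (P \cap K_1(n)) when L / F is unramified. *)
Lemma Kgrp_mirabolic (n : nat) (g : M) : e = 1%N -> (0 < n)%N ->
  (forall i j, I n%:Z ((g - 1) i j)) ->
  exists l a b, [/\ unit_grp vL 1 l, unit_grp v n a, I n%:Z b
    & g = iota l * (upper b * dg a)].
Proof.
move=> e1 n0 hg; have d0 := d_neq0.
have vd0 : v d = 0 by rewrite vd e1.
have E00 := hg 0 0; have E01 := hg 0 1; have E10 := hg 1 0; have E11 := hg 1 1.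
rewrite !mxE /= ?subr0 in E00 E01 E10 E11.
have Iw m t : I n%:Z t -> (m <= n)%N -> I m%:Z t by move=> ht mn; apply: idealW ht; lia.
pose x := g 0 0; pose y := g 0 1; pose z := g 1 0; pose w := g 1 1.
have [xU wU] : unit_grp v n x /\ unit_grp v n w.
  by split; rewrite -[X in unit_grp _ _ X](subrK 1) addrC; exact: (unit_grp_add1 vP).
pose D := x * w - y * z.
have DU : unit_grp v n D.
  have -> : D = 1 + (x * w - 1 - y * z) by rewrite /D; ring.
  apply: (unit_grp_add1 vP) => //; apply: (idealB vP).
    by have [] := unit_grpM vP xU wU.
  by apply: (ideal0M vP) => //; exact: (Iw 0).
have [[x0 vx _] [w0 vw _] [D0 vD hD]] := And3 xU wU DU.
have DV : unit_grp v n D^-1 by exact: (unit_grpV vP).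
have int t : t != 0 -> v t = 0 -> I 0 t by move=> _ vt; right; rewrite vt.
have DVI : I 0 D^-1 by case: DV => h0 hv _; exact: int.
have dVI : I 0 d^-1 by right; rewrite (val_inv vP) // vd0.
have gE : g = mx22 x y z w by exact: mx22_eta.
have gu : g \in unitmx by rewrite gE mx22_unit.
have hE : invmx g = mx22 (w / D) (- y / D) (- z / D) (x / D).
  have gg : g * mx22 (w / D) (- y / D) (- z / D) (x / D) = 1.
    rewrite gE mul_mx22 -mx22_1; congr (mx22 _ _ _ _); rewrite /D; field;
    exact: D0.
  have vg : invmx g * g = 1 by rewrite -mulmxE mulVmx.
  by rewrite -[LHS]mulr1 -gg mulrA vg mul1r.
have [l [l0 lE lg]] := iota_mirabolic gu.
move: lE; rewrite hE !mxE /= => lE.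
have iE : iota l = mx22 (x / D) (- z / D / d) (- z / D) (x / D).
  by rewrite lE (embedE _ sF) divfK.
have A_E : (iota l * g) 0 0 = x * x / D - z * z / D / d.
  by rewrite iE gE mul_mx22 mxE /=; ring.
have B_E : (iota l * g) 0 1 = x * y / D - z * w / D / d.
  by rewrite iE gE mul_mx22 mxE /=; ring.
have lU : unit_grp vL 1 l.
  have -> : l = 1 + ((x / D - 1)%:A + (- z / D / d) *: s).
    by rewrite lE scalerBl scale1r; ring.
  have [_ vs] := quad_ramE Fp p_neq2 L_quad s2 sF vd01.
  apply: (unit_grp_add1 vLP) => //; apply: (idealD vLP).
    apply: (@idealW _ _ _ (e%:Z * n%:Z)); first by rewrite e1 mul1r lez_nat.
    rewrite (quad_ideal_alg L_quad s2 sF).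
    by have [] := unit_grpM vP xU DV.
  apply: (@idealW _ _ _ (e%:Z * n%:Z + vL s)); first by rewrite e1 vs vd0 mul1r addr0 lez_nat.
  rewrite (quad_ideal_sE L_quad s2 sF).
  by do 2 (apply: (idealM0 vP) => //); exact: (idealN vP).
exists l^-1, (x * x / D - z * z / D / d), (x * y / D - z * w / D / d); split.
- exact: (unit_grpV vLP).
- have -> : x * x / D - z * z / D / d = 1 + ((x * x / D - 1) - z * z / D / d) by ring.
  apply: (unit_grp_add1 vP) => //; apply: (idealB vP).
    by have [] := unit_grpM vP (unit_grpM vP xU xU) DV.
  by do 3 (apply: (idealM0 vP) => //); exact: (Iw 0).
- apply: (idealB vP).
    by apply: (idealM0 vP) => //; apply: (ideal0M vP) => //; exact: int.
  by do 3 (apply: (idealM0 vP) => //); exact: int.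
by rewrite upper_dg -A_E -B_E -lg mulrA -(embedM L_quad s2 sF) mulVf // iota1 mul1r.
Qed.

(** For even c, [ell] is the coordinate on the line [V]. For odd c it is u |-> T u 1 in the induced
    model: by [Kgrp_mirabolic] each g in J^1 is an element of B^1 times some diag(a, 1) in J^1, so T
    u g is a multiple of [ell (Lam (dg a) u)], and all of these being zero forces T u = 0. *)
Lemma minimal_functional : exists ell : V -> C,
  [/\ forall a u w, ell (a *: u + w) = a * ell u + ell w,
      forall b u, I n1%:Z b -> ell (Lam (upper b) u) = psi (b / varpi ^+ k) * ell u,
      forall a u, unit_grp v N a -> ell (Lam (dg a) u) = ell u
    & forall u, (forall a, unit_grp v 0 a -> J (dg a) -> ell (Lam (dg a) u) = 0) ->
        u = 0].
Proof.
case oc : (odd c); move: Lam_def; rewrite /inducing_rep oc; last first.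
  move=> [dV LamE].
  exists (fun u => \sum_i coord (vbasis {:V}) i u).
  have ellZ t u : \sum_i coord (vbasis {:V}) i (t *: u) =
      t * \sum_i coord (vbasis {:V}) i u.
    by rewrite mulr_sumr; apply: eq_bigr => i _; rewrite linearZ.
  have actE g u : J g -> Lam g u = tht g *: u.
    by move=> Jg; rewrite LamE // scale_lfunE id_lfunE.
  split.
  - move=> a u w; rewrite -ellZ -big_split /=; apply: eq_bigr => i _.
    by rewrite linearD.
  - by move=> b u hb; rewrite actE ?ellZ ?tht_upper //; exact: J_upper.
  - by move=> a u hb; rewrite actE ?ellZ ?tht_dg ?mul1r //; exact: J_dg.
  move=> u hu; apply: coord_sum_injective => //.
  have U1 : unit_grp v N 1 by exact: unit_grp1.
  have := hu 1 (unit_grp1 vP 0) (J_dg U1).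
  by rewrite actE; [rewrite tht_dg // scale1r|exact: J_dg].
move=> [_ _ [T [Tlin Tinj TP Tact]] _ _].
have e1 := odd_ramification oc.
have kc : k = c by rewrite e1 divn1.
have c20 : (0 < c./2)%N by move: c_ge2; lia.
have J1one : grpJ1 v vL e c iota 1 by have := deep_J1 deep0; rewrite addr0.
have Tind u : ind_space v vL e c iota tht (T u) by apply/TP; exists u.
have TactE g u : grpJ1 v vL e c iota g -> T (Lam g u) 1 = T u g.
  by move=> Jg; rewrite Tact // mul1r.
have TB g u : B1 g -> grpJ1 v vL e c iota g -> T (Lam g u) 1 = tht g * T u 1.
  by move=> Bg Jg; rewrite TactE // -[g in T u g]mulr1 (Tind u).2.
exists (fun u => T u 1); split=> //.
- move=> b u hb; have [x dx bE] := upper_deep hb.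
  by rewrite -tht_upper //; apply: TB; rewrite bE; [exact: deep_B1|exact: deep_J1].
- move=> a u ha; have [x dx aE] := dg_deep ha.
  rewrite TB ?tht_dg ?mul1r //; rewrite aE; [exact: deep_B1|exact: deep_J1].
move=> u hu.
have T0 h : T 0 h = 0.
  have := Tlin 1 0 0 h; rewrite scale1r addr0 mul1r => /eqP.
  by rewrite -subr_eq subrr => /eqP.
apply: Tinj; apply/funext => g; rewrite T0.
have [[l [kap [lU [x hx <-] gE]]]|nJ] := pselect (grpJ1 v vL e c iota g); last first.
  exact: (Tind u).1.
have xI i j : I c./2%:Z (x i j).
  by apply: (power_ideal1_sub vP); move: hx; rewrite e1.
have [|l' [a [b [lU' aU hb kE']]]] := @Kgrp_mirabolic c./2 (1 + x) e1 c20.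
  by move=> i j; rewrite addrC addKr.
have hb1 : I n1%:Z b by rewrite kc.
have [y dy bE] := upper_deep hb1.
have dgJ1 : grpJ1 v vL e c iota (dg a).
  exists 1, (dg a); rewrite iota1 mul1r; split=> //; first exact: unit_grp1.
  exists (mx22 (a - 1) 0 0 0); last by apply: matrix2P; rewrite !mxE /=; ring.
  rewrite e1; apply: (power_ideal1P vP varpi0 v_varpi) => // i j.
  have [_ _ ha] := aU.
  by case: (ord2E i) => ->; case: (ord2E j) => ->; rewrite mxE //=; exact: ideal0.
rewrite gE kE' !mulrA -(embedM L_quad s2 sF) (Tind u).2 //; last first.
  rewrite /grpB1 oc; have [_ /(_ oc) h] := deep_power_ideal dy.
  exists (l * l'), (1 + y); rewrite bE; split=> //; last by exists y.
  exact: (unit_grpM vLP).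
rewrite -TactE // hu ?mulr0 //; first exact: unit_grpW aU.
have [_ [l1 [k1 [[l10 _ _] k1K ->]]]] := (I, dgJ1).
by exists l1, k1.
Qed.

Local Notation pi := (cInd v J Lam).

Lemma minimal_scal f (a : F) : pi f -> a != 0 -> right_translate (scal a) f = f.
Proof. by apply: cInd_scal; [exact: J_scal|exact: Lam_scal]. Qed.

Lemma minimal_newvec_unique f f' : newvec v J Lam k n2 f -> newvec v J Lam k n2 f' ->
  f' != 0 -> exists a : C, f = a *: f'.
Proof.
have [ell [ell_lin ell_up ell_dg ell_inj]] := minimal_functional.
exact: (newvec_unique vP varpi0 v_varpi psi_char kE N_gt0 d_neq0 n2E J_upper J_dg
  J_omega J_scal Lam_scal J_cover ell_lin ell_up ell_dg ell_inj).
Qed.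

Variable ip : (M -> V) -> (M -> V) -> C.
Hypothesis ipP : invariant_inner_product pi ip.
Variables phi0 phinew : M -> V.
Hypothesis phi0_min : minimal_vector v vL e c iota tht pi ip phi0.
Hypothesis phinew_new : newform v pi ip phinew.

Lemma minimal_vector_dg a : unit_grp v N a -> right_translate (dg a) phi0 = phi0.
Proof.
have [_ phi0B _] := phi0_min.
move=> ha; have [x dx aE] := dg_deep ha.
by rewrite phi0B ?tht_dg ?scale1r // aE; exact: deep_B1.
Qed.

Lemma newform_expansion (T : finType) (z : T -> F) : (0 < #|T|)%N ->
  rep_system (unit_grp v 0) (fun x y => I N%:Z (x - y)) z ->
  exists a : C, diag_translate (varpi ^+ k) phinew =
      a *: \sum_i diag_translate (z i) phi0 /\
    a * (a^*)%C * #|T|%:R = 1.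
Proof.
move=> T0 zP; have [pphi0 phi0B phi0n] := phi0_min.
have kn2 : (k <= n2)%N := leq_ramified k e12.
apply: (newform_sum_phi vP varpi0 v_varpi psi_char kE kn2 ipP minimal_scal pphi0 _
  minimal_vector_dg _ phi0n zP) => //.
- move=> b hb; have [x dx bE] := upper_deep hb.
  by rewrite phi0B ?tht_upper // bE; exact: deep_B1.
- move=> b hb; have [x dx bE] := lower_deep hb.
  by rewrite phi0B ?tht_lower ?scale1r // bE; exact: deep_B1.
- by rewrite ltn_addr // k_gt0.
exact: minimal_newvec_unique.
Qed.

End MinimalTypes.

Lemma quad_generator_notin_base (F : fieldType) (E : fieldExtType F) (s : E) :
  \dim {:E} = 2%N -> <<1; s>>%VS = {:E}%VS -> forall a : F, s != a%:A.
Proof.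
move=> dE gen a; apply/eqP => sa.
have s1 : s \in 1%VS by rewrite sa memvZ // mem1v.
by move: dE; rewrite -gen (Fadjoin_idP s1) dimv1.
Qed.

Theorem proposition3p3
  (R : realType)
  (* the p-adic field F *)
  (F : fieldType) (v : F -> int) (p q : nat)
  (F_padic : padic_field v p q) (p_neq2 : p <> 2%N)
  (varpi : F) (varpi_neq0 : varpi != 0) (v_varpi : v varpi = 1)
  (psi : F -> R[i]) (psi_char : unramified_add_char v psi)
  (* the quadratic extension L and the character theta *)
  (L : fieldExtType F) (vL : L -> int) (eL : nat)
  (L_quad : quadratic_ext v vL eL)
  (theta : L -> R[i]) (theta_char : mult_char vL theta)
  (theta_triv : trivial_on_base theta)
  (c : nat) (theta_cond : conductor vL theta c) (c_ge2 : (2 <= c)%N)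
  (c_even : eL = 2%N -> ~~ odd c)
  (alpha : L) (alpha_neq0 : alpha != 0) (alpha_tr0 : field_trace alpha = 0)
  (alphaP : forall u, ideal_pow vL (uphalf c)%:Z u ->
     theta (1 + u) = psi (field_trace (alpha * u)))
  (* the embedding of L into 2 x 2 matrices *)
  (D' : F) (D'_def : D'%:A = alpha ^- 2 * (varpi%:A) ^- (2 * c %/ eL)%N)
  (iotaL : L -> 'M[F]_2)
  (iotaL_def : iotaL = embed (alpha^-1 * (varpi%:A) ^- (c %/ eL)%N) D')
  (* the character theta~, the representation Lambda, and pi = c-Ind Lambda *)
  (tht : 'M[F]_2 -> R[i])
  (tht_def : theta_tilde v vL eL c iotaL theta psi alpha tht)
  (V : vectType R[i]) (Lambda : 'M[F]_2 -> 'End(V))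
  (Lambda_def : inducing_rep v vL eL c iotaL theta tht q Lambda)
  (pi : set ('M[F]_2 -> V)) (pi_def : pi = cInd v (grpJ v eL c iotaL) Lambda)
  (ip : ('M[F]_2 -> V) -> ('M[F]_2 -> V) -> R[i])
  (ip_inner : invariant_inner_product pi ip)
  (phi0 phinew : 'M[F]_2 -> V)
  (phi0_min : minimal_vector v vL eL c iotaL tht pi ip phi0)
  (phinew_new : newform v pi ip phinew)
  (* the quadratic extension E, the character chi and the Haar measure *)
  (E : fieldExtType F) (vE : E -> int) (eE : nat)
  (E_quad : quadratic_ext v vE eE)
  (D : F) (vD : v D = 0 \/ v D = 1)
  (sqrtD : E) (sqrtDP : sqrtD ^+ 2 = D%:A) (E_gen : <<1; sqrtD>>%VS = {:E}%VS)
  (chi : E -> R[i]) (chi_char : mult_char vE chi)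
  (chi_triv : trivial_on_base chi)
  (mu : {measure set (g_sigma_algebraType (saturated_open vE)) -> \bar R})
  (mu_haar : haar_measure mu)
  (per : ('M[F]_2 -> V) -> ('M[F]_2 -> V) -> R[i])
  (per_def : per = period mu ip (embed sqrtD D) chi)
  (N : nat) (N_def : N = ceil_div c (2 * eL))
  (x : F) (x_unit : unit_grp v 0 x)
  (x_neq0 : per (diag_translate x phi0) (diag_translate x phi0) != 0)
  (x_single : forall y, unit_grp v 0 y ->
     per (diag_translate y phi0) (diag_translate y phi0) != 0 ->
     ideal_pow v N%:Z (y - x)) :
  (forall y y', unit_grp v 0 y -> unit_grp v 0 y' ->
     ~ ideal_pow v N%:Z (y - y') ->
     per (diag_translate y phi0) (diag_translate y' phi0) = 0)
  /\
  per (diag_translate (varpi ^+ (c %/ eL)%N) phinew)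
      (diag_translate (varpi ^+ (c %/ eL)%N) phinew)
  = (((q - 1) * q ^ (N - 1))%N%:R)^-1
    * per (diag_translate x phi0) (diag_translate x phi0).
Proof.
have vP := padic_val F_padic.
have [e12 cE s2 sF vd] := minimal_element F_padic p_neq2 varpi_neq0 v_varpi psi_char
  L_quad theta_cond c_ge2 c_even alpha_neq0 alpha_tr0 alphaP D'_def.
have alpha_s : alpha * (alpha^-1 * (varpi%:A) ^- (c %/ eL)%N) =
    (varpi ^- (c %/ eL)%N)%:A by rewrite mulrA mulfV // mul1r algV algX.
subst iotaL pi per.
have scal_triv := minimal_scal psi_char theta_triv sF tht_def Lambda_def.
have EF := quad_generator_notin_base (quad_dim E_quad) E_gen.
have lin := period_lin F_padic p_neq2 varpi_neq0 v_varpi E_quad sqrtDP EF vD chi_char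
  chi_triv mu_haar ip_inner scal_triv.
have herm := period_herm F_padic p_neq2 varpi_neq0 v_varpi E_quad sqrtDP EF vD chi_char
  chi_triv mu_haar ip_inner scal_triv.
have eq0 := period_eq0 F_padic p_neq2 varpi_neq0 v_varpi E_quad sqrtDP EF vD chi_char
  chi_triv mu_haar ip_inner scal_triv.
have [pphi0 _ _] := phi0_min.
pose J := grpJ v eL c (embed (alpha^-1 * (varpi%:A) ^- (c %/ eL)%N) D').
have pphi y : unit_grp v 0 y -> cInd v J Lambda (diag_translate y phi0).
  by case=> y0 _ _; exact: (pi_phi vP varpi_neq0 v_varpi pphi0).
(* From here on the period is an abstract Hermitian form, known only through linearity, symmetry and
   the consequence of Cauchy-Schwarz. *)
move: (period mu ip _ chi) lin herm eq0 x_neq0 x_single => per lin herm eq0 x_neq0 x_single.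
have zero y y' : unit_grp v 0 y -> unit_grp v 0 y' ->
    per (diag_translate y phi0) (diag_translate y phi0) = 0 ->
    per (diag_translate y phi0) (diag_translate y' phi0) = 0 /\
    per (diag_translate y' phi0) (diag_translate y phi0) = 0.
  move=> yU yU' y0; have h := eq0 _ _ (pphi y yU) (pphi y' yU') y0.
  by split=> //; rewrite herm ?h ?rmorph0 //; exact: pphi.
have off y y' : unit_grp v 0 y -> unit_grp v 0 y' -> ~ ideal_pow v N%:Z (y - y') ->
    per (diag_translate y phi0) (diag_translate y' phi0) = 0.
  move=> yU yU' nyy.
  (* If neither diagonal value vanishes, y and y' are both congruent to x, hence to each other. *)
  have [h|h] := eqVneq (per (diag_translate y phi0) (diag_translate y phi0)) 0.
    by have [] := zero _ _ yU yU' h.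
  have [h'|h'] := eqVneq (per (diag_translate y' phi0) (diag_translate y' phi0)) 0.
    by have [] := zero _ _ yU' yU h'.
  case: nyy; have -> : y - y' = (y - x) - (y' - x) by ring.
  by apply: (idealB vP); exact: x_single.
split=> //.
have N0 : (0 < N)%N.
  have := quotient_gt0 c_ge2 cE.
  by rewrite (ceil_div_half e12 cE N_def); case: (c %/ eL)%N.
have [T [z [zP cT]]] := rep_system_units F_padic varpi_neq0 v_varpi N0.
have [i0 [xi0 ui0]] := zP.2 _ x_unit.
have T0 : (0 < #|T|)%N by apply/card_gt0P; exists i0.
have [a [-> aT]] := newform_expansion F_padic p_neq2 varpi_neq0 v_varpi psi_char L_quad
  theta_triv c_ge2 c_even e12 cE s2 sF vd alpha_s tht_def Lambda_def N_def ip_inner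
  phi0_min phinew_new T0 zP.
have pz i : cInd v J Lambda (diag_translate (z i) phi0) := pphi _ (zP.1 i).
have psum := cInd_sum vP varpi_neq0 v_varpi pz.
rewrite (sesqZl lin) //; last exact: (cIndZ vP varpi_neq0 v_varpi).
rewrite (sesqZr vP varpi_neq0 v_varpi lin herm) // mulrA.
have n0 : (#|T|%:R : R[i]) != 0 by rewrite pnatr_eq0 -lt0n.
(* The newform has norm 1 and is a times a sum of [#|T|] orthonormal vectors. *)
have -> : a * (a^*)%C = #|T|%:R^-1 by apply: (mulIf n0); rewrite aT mulVf.
rewrite cT; congr (_ * _).
rewrite (sesq_suml vP varpi_neq0 v_varpi lin) // (bigD1 i0) //=.
have zeq : diag_translate (z i0) phi0 = diag_translate x phi0.
  symmetry; apply: (phi_eq vP _ x_unit (zP.1 i0) xi0).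
  exact: (minimal_vector_dg F_padic p_neq2 varpi_neq0 v_varpi psi_char L_quad
    theta_triv c_ge2 c_even e12 cE s2 sF vd alpha_s tht_def N_def phi0_min).
have far i j : i != j -> ~ ideal_pow v N%:Z (z i - z j).
  move=> ij h; case/eqP: ij; have [l [_ ul]] := zP.2 _ (zP.1 i).
  by rewrite -(ul _ h); apply/esym/ul; rewrite subrr; exact: ideal0.
have row i : per (diag_translate (z i) phi0) (\sum_j diag_translate (z j) phi0) =
    per (diag_translate (z i) phi0) (diag_translate (z i) phi0).
  rewrite (sesq_sumr vP varpi_neq0 v_varpi lin herm) // (bigD1 i) //= big1 ?addr0 //.
  by move=> j ji; apply: off; [exact: zP.1|exact: zP.1|apply: far; rewrite eq_sym].
(* Each row of the Gram matrix reduces to its diagonal entry, and only the class [i0] of x has a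
   nonzero one. *)
rewrite row zeq big1 ?addr0 // => i ii0; rewrite row.
apply/eqP; apply/negPn/negP => /(x_single _ (zP.1 i)) xi.
case/eqP: ii0; apply/esym/ui0; exact: (idealBC vP).
Qed.
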